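(* Let $\alpha\in(0,2)$ and let $r,h$ be given constants with $r>0$. Then there is a constant $c(r,h)$ such that any orbit of energy $h$ of the dihedral four-body problem beginning in the region where $\rho\le r$ and $v\ge c(r,h)$ is of the following type: two opposite edges of the configuration formed by the four bodies are always the shortest and remain bounded, while $\rho$ tends monotonically to infinity.
   Context: Let $\alpha\in(0,2)$, $\beta=\alpha/2$. The dihedral four-body problem has four equal masses located at the orbit $\{gq:g\in D_2\}$ of a point $q=(q_1,q_2,q_3)\in\mathbb R^3$ under the group $D_2\subset SO(3)$ generated by the rotations of angle $\pi$ about the coordinate axes. With masses normalized, the reduced system is $\ddot q=\nabla U(q)$ with $U(q)=\sum_{g\in D_2\setminus\{1\}}|q-gq|^{-\alpha}=2^{-\alpha}\big[(q_1^2+q_2^2)^{-\beta}+(q_2^2+q_3^2)^{-\beta}+(q_1^2+q_3^2)^{-\beta}\big]$ and energy $h=\tfrac12|\dot q|^2-U(q)$. The four bodies form a (possibly degenerate) tetrahedron whose six edges are grouped into three pairs of opposite edges of equal length. McGehee coordinates: $\rho=|q|$, $s=q/\rho\in S^2$, $z=\rho^\beta\dot q$, $v=\langle z,s\rangle$, $w=z-vs$, with new time $\tau$, $dt=\rho^{1+\beta}d\tau$. The equations of motion are $\rho'=\rho v$, $v'=|w|^2+\beta v^2-\alpha U(s)$, $s'=w$, $w'=-|w|^2s+(\beta-1)vw+\nabla_sU(s)$ ($\nabla_sU$ the gradient of $U|_{S^2}$ for the round metric), and the energy relation is $2\rho^\alpha h=|w|^2+v^2-2U(s)$. Orbits are continued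 through (simultaneous) double collisions by regularization. *)

(* Defs.v *)
From mathcomp Require Import all_boot all_order all_algebra.
From mathcomp Require Import all_classical all_reals all_analysis.

Set Implicit Arguments.
Unset Strict Implicit.
Unset Printing Implicit Defensive.

Import Order.TTheory GRing.Theory Num.Theory.
Import numFieldNormedType.Exports.

Local Open Scope ring_scope.
Local Open Scope classical_set_scope.

(* The library norm on 'rV[R]_3 is the sup norm (with the same topology), so
   the Euclidean norm is defined separately. *)
Definition dot (R : realType) (x y : 'rV[R]_3) : R := \sum_i x 0 i * y 0 i.

Definition enorm (R : realType) (x : 'rV[R]_3) : R := Num.sqrt (dot x x).

Definition grad (R : realType) (f : 'rV[R]_3 -> R) (x : 'rV[R]_3) : 'rV[R]_3 :=
  \row_i 'D_(delta_mx 0 i) f x.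

(* [None] is the identity of D_2 and [Some k] the rotation of angle pi about
   the k-th coordinate axis. *)
Definition D2 : finType := option 'I_3.

Definition D2mx (R : realType) (g : D2) : 'M[R]_3 :=
  if g is Some k then diag_mx (\row_j (if j == k then 1 else -1)) else 1%:M.

Definition body (R : realType) (q : 'rV[R]_3) (g : D2) : 'rV[R]_3 :=
  q *m D2mx R g.

Definition edge (R : realType) (q : 'rV[R]_3) (g g' : D2) : R :=
  enorm (body q g - body q g').

Definition collision (R : realType) (q : 'rV[R]_3) : Prop :=
  exists g g' : D2, g != g' /\ body q g = body q g'.

Definition potential (R : realType) (alpha : R) (q : 'rV[R]_3) : R :=
  \sum_(g : D2 | g != None) enorm (q - body q g) `^ (- alpha).

Definition energy (R : realType) (alpha : R) (q p : 'rV[R]_3) : R :=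
  enorm p ^+ 2 / 2 - potential alpha q.

Definition rho (R : realType) (q : 'rV[R]_3) : R := enorm q.

Definition mcgehee_s (R : realType) (q : 'rV[R]_3) : 'rV[R]_3 :=
  (rho q)^-1 *: q.

Definition mcgehee_z (R : realType) (alpha : R) (q p : 'rV[R]_3) : 'rV[R]_3 :=
  rho q `^ (alpha / 2) *: p.

Definition mcgehee_v (R : realType) (alpha : R) (q p : 'rV[R]_3) : R :=
  dot (mcgehee_z alpha q p) (mcgehee_s q).

Definition velocity (R : realType) (q : R -> 'rV[R]_3) : R -> 'rV[R]_3 :=
  q^`().

(* An orbit of energy h on the time interval ]S, T[, continued through double
   collisions.  The velocity blows up at a double collision, but every
   regularization keeps q, the energy and the McGehee coordinate v continuous;
   v t stands for the extended coordinate.  How the direction of the colliding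
   pairs is continued depends on the regularization (and on alpha) and is left
   free.  Total collision (q = 0) is not regularized. *)
Record regularized_orbit (R : realType) (alpha h : R) (S T : \bar R)
    (q : R -> 'rV[R]_3) (v : R -> R) : Prop := RegularizedOrbit {
  orbit_continuous : forall t, (S < t%:E < T)%E -> {for t, continuous q};
  orbit_neq0 : forall t, (S < t%:E < T)%E -> q t != 0;
  orbit_collisions : forall a b, (S < a%:E)%E -> (b%:E < T)%E ->
    finite_set [set t | a <= t <= b /\ collision (q t)];
  orbit_derivable : forall t, (S < t%:E < T)%E -> ~ collision (q t) ->
    derivable q t 1 /\ derivable (velocity q) t 1;
  orbit_newton : forall t, (S < t%:E < T)%E -> ~ collision (q t) ->
    (velocity q)^`() t = grad (potential alpha) (q t);
  orbit_energy : forall t, (S < t%:E < T)%E -> ~ collision (q t) ->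
    energy alpha (q t) (velocity q t) = h;
  orbit_v : forall t, (S < t%:E < T)%E -> ~ collision (q t) ->
    v t = mcgehee_v alpha (q t) (velocity q t);
  orbit_v_continuous : forall t, (S < t%:E < T)%E -> {for t, continuous v}
}.

(* A regularized orbit cannot stop at a finite time at which it converges to a
   configuration other than total collision: from a collision-free one it goes
   on by the equation of motion, from a double collision by regularization. *)
Definition forward_maximal (R : realType) (T : \bar R) (q : R -> 'rV[R]_3) :
    Prop :=
  forall (b : R) (l : 'rV[R]_3), T = b%:E -> q t @[t --> b^'-] --> l -> l = 0.

(* For distinct a, b, c, d, the edges ab and cd are opposite, and the other
   four edges are those from {a, b} to {c, d}. *)
Definition shortest_pair (R : realType) (q : 'rV[R]_3) (a b c d : D2) : Prop :=
  forall g g' : D2, g \in [:: a; b] -> g' \in [:: c; d] ->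
    edge q a b < edge q g g' /\ edge q c d < edge q g g'.

(* Main.v *)
Require Import Defs.
From mathcomp Require Import all_boot all_order all_algebra.
From mathcomp Require Import all_classical all_reals all_analysis.
From mathcomp Require Import ring lra.
Import Order.TTheory GRing.Theory Num.Theory.
Import numFieldNormedType.Exports.
Local Open Scope ring_scope.
Local Open Scope classical_set_scope.

(** If [v] is large while [rho] is bounded, the bodies form two binaries whose
    centres fly apart along a coordinate axis so fast that they can never turn
    back; all the energy they carry away has to be paid for by the binaries,
    which are therefore tightly bound forever.

    In detail, let [b = alpha / 2], let [x] be the coordinate of [q] along its
    dominant axis, oriented so that [x > 0], and [y], [z] the other two.  The
    force along the axis comes from the four long edges only; it is attractive,
    and never stronger than if both binaries had shrunk to points.  Hence
    [J = x'^2 / 2 - 2 kap x^(-alpha)], with [kap = 4^(-b)], is nondecreasing while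
    [x' >= 0] ([is_derive_axial_energy]), and once [J > 0] the speed [x'] never
    drops below [sqrt (2 J)] ([axial_escape], a continuity argument).  A large
    [v] guarantees initially that both [J] and [J - h] exceed
    [N = 100 rho^(-alpha)] ([initial_bounds]).  Energy conservation then leaves
    the binaries an energy of at most [- N] for all later times
    ([binary_kinetic_le]), so [y^2 + z^2] is at most [x^2 / 4]
    ([transverse_le_axial]): the edges inside the binaries are bounded and the
    shortest.  Finally [rho rho' = x x' + (y y' + z z')], where the second term
    is too small to change the sign ([radius_increasing]).

    Double collisions are crossed thanks to [alpha < 2].  The regularization
    keeps [rho rho' = rho^(1-b) v] continuous, and [y y' + z z'] tends to [0] at a
    collision because its square is of order [(y^2 + z^2)^(1-b)]; so [x'] extends
    continuously ([axial_velocity_continuous]), and monotonicity follows from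
    the sign of derivatives off a finite set ([increasing_off_finite]).

    The orbit exists for all future time: otherwise [q] would converge at the
    final time ([position_cvg]).  For [x] this holds because [x'] stays between
    [0] and its initial value; for [y] and [z] one uses that [y^2 + z^2] has the
    bounded derivative [2 (y y' + z z')]. *)

(** * Monotonicity off a finite set, and limits *)

(** The mean value theorem on each of the finitely many intervals cut out by
    [s]: continuity glues the pieces.  The boolean [C] chooses between the
    weak and the strict inequality, as for [lteif]. *)
Lemma increasing_off_seq {R : realType} (C : bool) (s : seq R) (f : R -> R) (a b : R) :
  a < b -> (forall t, a <= t <= b -> {for t, continuous f}) ->
  (forall t, a < t < b -> t \notin s ->
     derivable f t 1 /\ 0 < derive1 f t ?<= if C) ->
  f a < f b ?<= if C.
Proof.
elim: s a b => [|c s IH] a b ab cf df.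
- have := @MVT R f (derive1 f) a b ab.
  case.
  + move=> t; rewrite in_itv /= => /df /(_ isT)[dft _].
    by rewrite derive1E; exact/derivableP.
  + apply: continuous_in_subspaceT => t; rewrite inE /= in_itv /=; exact: cf.
  + move=> t; rewrite in_itv /= => /df /(_ isT)[_ f0] e.
    rewrite -[X in _ < X ?<= if _](subrK (f a)) e.
    by clear df; case: C f0 => /= f0; nra.
- have [/andP[ac cb]|ncab] := boolP (a < c < b).
  + rewrite -(andbb C); apply: (lteif_trans (y := f c)); apply: IH => //.
    * by move=> t /andP[h1 h2]; apply: cf; rewrite h1 (le_trans h2)// ltW.
    * move=> t /andP[h1 h2] ts; apply: df; first by rewrite h1 (lt_trans h2).
      by rewrite inE negb_or ts lt_eqF.
    * by move=> t /andP[h1 h2]; apply: cf; rewrite h2 andbT (le_trans _ h1)// ltW.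
    * move=> t /andP[h1 h2] ts; apply: df; first by rewrite h2 andbT (lt_trans ac).
      by rewrite inE negb_or ts gt_eqF.
  + apply: IH => // t tab ts; apply: df => //; rewrite inE negb_or ts andbT.
    by apply: contraNneq ncab => <-.
Qed.

Lemma increasing_off_finite {R : realType} (C : bool) (P : R -> Prop) (f : R -> R) (a b : R) :
  finite_set [set t | a <= t <= b /\ P t] ->
  a < b -> (forall t, a <= t <= b -> {for t, continuous f}) ->
  (forall t, a < t < b -> ~ P t ->
     derivable f t 1 /\ 0 < derive1 f t ?<= if C) ->
  f a < f b ?<= if C.
Proof.
move=> /finite_seqP[s sE] ab cf df; apply: (@increasing_off_seq _ C s) => //.
move=> t /[dup] tab /andP[h1 h2] ts; apply: df => // Pt.
have : [set` s] t by rewrite -sE /=; rewrite !ltW.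
by move=> /= ts'; rewrite ts' in ts.
Qed.

Lemma nondecreasing_off_finite {R : realType} (P : R -> Prop) (f : R -> R) (a b : R) :
  finite_set [set t | a <= t <= b /\ P t] ->
  a <= b -> (forall t, a <= t <= b -> {for t, continuous f}) ->
  (forall t, a < t < b -> ~ P t -> derivable f t 1 /\ 0 <= derive1 f t) ->
  f a <= f b.
Proof.
move=> fin; rewrite le_eqVlt => /predU1P[->//|ab].
exact: (@increasing_off_finite _ true).
Qed.

Lemma lipschitz_off_finite {R : realType} (P : R -> Prop) (f : R -> R) (a b M : R) :
  finite_set [set t | a <= t <= b /\ P t] ->
  a <= b -> (forall t, a <= t <= b -> {for t, continuous f}) ->
  (forall t, a < t < b -> ~ P t -> derivable f t 1 /\ `|derive1 f t| <= M) ->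
  `|f b - f a| <= M * (b - a).
Proof.
move=> fin ab cf df.
(* Both signs of [f b - f a] at once: [M t - e f t] is nondecreasing. *)
have key (e : R) : `|e| = 1 -> e * (f b - f a) <= M * (b - a).
  move=> e1.
  have := @nondecreasing_off_finite _ P (fun t => M * t - e * f t) a b fin ab.
  have H : forall t, a < t < b -> ~ P t -> 
     is_derive t 1 (fun t => M * t - e * f t) (M - e * derive1 f t).
    move=> t tab Pt; have [d _] := df t tab Pt.
    have D : is_derive t 1 f (derive1 f t) by rewrite derive1E; exact/derivableP.
    apply: is_derive_eq.
    by rewrite /GRing.scale /=; ring.
  have -> : e * (f b - f a) <= M * (b - a) =
    (M * a - e * f a <= M * b - e * f b) by apply/idP/idP => ?; lra.
  apply.
  - move=> t tab; apply: continuousB; apply: continuousM; try exact: cst_continuous.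
    exact: cvg_id. exact: cf.
  - move=> t tab Pt; have D := H t tab Pt; split; first exact: ex_derive.
    rewrite derive1E derive_val subr_ge0.
    have [_ ] := df t tab Pt.
    apply: le_trans; rewrite (le_trans (ler_norm _))// normrM e1 mul1r//.
have := key 1 (normr1 R); have := key (-1); rewrite normrN1 => /(_ erefl).
by rewrite ler_norml => ? ?; apply/andP; split; lra.
Qed.

(** The bootstrap principle: the set of times up to which [P] has held is
    closed and right-open, so its supremum cannot be below [b]. *)
Lemma real_induction {R : realType} (P : R -> Prop) (a b : R) :
  (forall t, a <= t <= b -> (forall s, a <= s < t -> P s) -> P t) ->
  (forall t, a <= t < b -> P t -> \forall s \near t^'+, P s) ->
  forall t, a <= t <= b -> P t.
Proof.
move=> cl op t0 /andP[at0 t0b].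
pose E := [set t | a <= t <= b /\ forall s, a <= s <= t -> P s].
have Pa : P a.
  apply: cl; first by rewrite lexx (le_trans at0).
  by move=> s /andP[h1 h2]; move: (le_lt_trans h1 h2); rewrite ltxx.
have Ea : E a.
  split; first by rewrite lexx (le_trans at0).
  by move=> s; rewrite -eq_le => /eqP <-.
have hs : has_sup E by split; [exists a|exists b => x [/andP[_ ?]]].
have sa : a <= sup E by apply: ub_le_sup => //; case: hs.
have sb : sup E <= b by apply: ge_sup => //; [exists a|move=> x [/andP[_ ?]]].
have Ps s : a <= s < sup E -> P s.
  move=> /andP[as_ ss]; move: (ss); rewrite -subr_gt0 => ss0.
  have [e [_ Ee] se] := sup_adherent ss0 hs.
  rewrite subKr in se; apply: Ee; rewrite as_ ltW//.
have Psup : P (sup E) by apply: cl => //; rewrite sa sb.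
have [sbE|] := eqVneq (sup E) b.
  have [|] := ltP t0 (sup E) => h; first by apply: Ps; rewrite at0.
  by have -> : t0 = sup E by apply/eqP; rewrite eq_le h sbE t0b.
rewrite neq_lt => /orP[sltb|]; last by rewrite ltNge sb.
have := op (sup E); rewrite sa sltb => /(_ isT Psup).
rewrite /at_right /within /= => /nbhs_ballP[e e0 He].
have e0' : 0 < e by exact: e0.
pose d := Num.min (sup E + e / 2) b.
have sd : sup E < d by rewrite lt_min sltb andbT; lra.
have : E d.
  split; first by rewrite ge_min lexx orbT andbT (le_trans sa (ltW sd)).
  move=> s /andP[h1 h2]; have [h3|h3|->//] := ltgtP s (sup E); first by apply: Ps; rewrite h1.
  apply: He => //; rewrite /ball /=.
  move: h2; rewrite le_min => /andP[h2 _].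
  by rewrite distrC ger0_norm; lra.
move=> Ed; have : d <= sup E by apply: ub_le_sup => //; case: hs.
by rewrite leNgt sd.
Qed.

(** [f t + M * t] is nondecreasing and bounded. *)
Lemma cvg_at_left_lipschitz {R : realType} (f : R -> R) (a b M : R) : a < b ->
  (forall s t, a <= s -> s <= t -> t < b -> `|f t - f s| <= M * (t - s)) ->
  cvg (f t @[t --> b^'-]).
Proof.
move=> ab lip.
have H s t : a <= s -> s <= t -> t < b ->
    - (M * (t - s)) <= f t - f s <= M * (t - s).
  by move=> ? ? ?; rewrite -ler_norml; exact: lip.
have M0 : 0 <= M.
  have : a <= (a + b) / 2 by lra.
  have hb : (a + b) / 2 < b by lra.
  move=> ha; have /andP[h1 h2] := H a _ (lexx a) ha hb.
  have : 0 <= M * ((a + b) / 2 - a) by lra.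
  rewrite pmulr_lge0//; lra.
have c1 : cvg ((f t + M * t) @[t --> b^'-]).
  apply: nondecreasing_at_left_is_cvgr.
    near=> x => s t; rewrite !in_itv /= => /andP[xs sb] /andP[xt tb] st.
    have ax : a < x by near: x; exact: nbhs_left_gt.
    have /andP[h1 h2] := H s t (ltW (lt_trans ax xs)) st tb; lra.
  near=> x; exists (f a + M * (b - a) + M * b) => _ [t + <-].
  rewrite /= in_itv /= => /andP[xt tb].
  have ax : a < x by near: x; exact: nbhs_left_gt.
  have /andP[h1 h2] := H a t (lexx a) (ltW (lt_trans ax xt)) tb; nra.
have c2 : cvg ((M * t) @[t --> b^'-]).
  apply/cvg_ex; exists (M * b); apply: cvgM; first exact: cvg_cst.
  by apply: cvg_at_left_filter; exact: cvg_id.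
have -> : (fun t => f t) = (fun t => (f t + M * t) - M * t).
  by apply/funext => t; rewrite addrK.
exact: is_cvgB.
Unshelve. all: by end_near. Qed.

Lemma ge_at_left {R : realType} (f : R -> R) (a t c : R) : a < t ->
  {for t, continuous f} -> (forall s, a <= s < t -> c <= f s) -> c <= f t.
Proof.
move=> a_t cf H.
apply: (cvgr_to_ge (cvg_at_left_filter cf)).
by near=> s; apply: H; apply/andP; split => //; near: s; exact: nbhs_left_ge.
Unshelve. all: by end_near. Qed.

Lemma nbhs_at_right {R : realType} (t : R) (P : R -> Prop) :
  (\forall s \near t, P s) -> \forall s \near t^'+, P s.
Proof. by apply: cvg_within. Qed.

Lemma derivable_continuous_at {R : realType} (f : R -> R) t :
  derivable f t 1 -> {for t, continuous f}.
Proof. by move=> d; apply/differentiable_continuous/derivable1_diffP. Qed.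

Lemma is_derive_sqr {R : realType} (f : R -> R) t : derivable f t 1 ->
  is_derive t 1 (fun s => f s ^+ 2) (2 * (f t * derive1 f t)).
Proof.
move=> df; have D : is_derive t 1 f (derive1 f t).
  by rewrite derive1E; exact: derivableP.
by apply: is_derive_eq; rewrite /GRing.scale /=; ring.
Qed.

Lemma sqr_continuous {R : realType} (f : R -> R) t : {for t, continuous f} ->
  {for t, continuous (fun s => f s ^+ 2)}.
Proof.
move=> cf; apply: (@cvg_comp _ _ _ f (fun r : R => r ^+ 2)); first exact: cf.
exact: exprn_continuous.
Qed.

(** * Powers with real exponents *)

Lemma ler_powRN {R : realType} (b x y : R) : 0 <= b -> 0 < x -> x <= y ->
  y `^ (- b) <= x `^ (- b).
Proof.
move=> b0 x0 xy; have y0 := lt_le_trans x0 xy.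
by rewrite !powRN lef_pV2 ?posrE ?powR_gt0// ge0_ler_powR// nnegrE ltW.
Qed.

(** The exponent is at least -1, so shrinking [a] by a factor [m] costs at most
    a factor [m]. *)
Lemma powRN_div {R : realType} (b a m : R) : 0 <= b <= 1 -> 0 < a -> 1 <= m ->
  (a / m) `^ (- b) <= m * a `^ (- b).
Proof.
move=> /andP[b0 b1] a0 m1; have m0 : 0 <= m by lra.
have mi0 : 0 <= m^-1 by rewrite invr_ge0.
rewrite powRM ?(ltW a0)// mulrC ler_wpM2r ?powR_ge0//.
rewrite -powR_inv1// -powRrM mulN1r opprK.
by rewrite -[leRHS]powRr1// ler_powR.
Qed.

Lemma mulr_powRN {R : realType} (b a : R) : 0 < a ->
  a * a `^ (- b) = a `^ (1 - b).
Proof. by move=> a0; rewrite powRD ?powRr1 ?(ltW a0)// (gt_eqF a0) implybT. Qed.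

Lemma powR_sqr {R : realType} (p x : R) : 0 <= x -> (x ^+ 2) `^ p = x `^ (2 * p).
Proof. by move=> x0; rewrite powRrM -powR_mulrn. Qed.

Lemma powR_continuous {R : realType} (p a : R) : 0 < a -> {for a, continuous (fun r : R => r `^ p)}.
Proof.
by move=> a0; apply/derivable_continuous_at/ex_derive; exact: is_derive1_powR.
Qed.

Lemma cvg_powR0 {R : realType} {T : Type} (F : set_system T) (f : T -> R) (p : R) :
  Filter F -> 0 < p -> (forall t, 0 <= f t) ->
  f t @[t --> F] --> (0 : R) -> f t `^ p @[t --> F] --> (0 : R).
Proof.
move=> FF p0 f0 cf; apply/cvgr0Pnorm_lt => eps eps0.
have d0 : 0 < eps `^ p^-1 by rewrite powR_gt0.
move/cvgr0Pnorm_lt : cf => /(_ _ d0); apply: filterS => t.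
rewrite !ger0_norm ?powR_ge0// => lt.
have -> : eps = (eps `^ p^-1) `^ p by rewrite -powRrM mulVf ?gt_eqF// powRr1// ltW.
by apply: gt0_ltr_powR => //; rewrite nnegrE // ltW.
Qed.

(** * Energy estimates at a single time *)

(** The potential in coordinates [x] along the axis of the binaries and [y, z]
    across it: the first term comes from the two short edges, the other two
    from the four long ones. *)
Definition axis_potential {R : realType} (b kap x y z : R) : R :=
  kap * ((y ^+ 2 + z ^+ 2) `^ (- b) + (x ^+ 2 + y ^+ 2) `^ (- b) +
         (x ^+ 2 + z ^+ 2) `^ (- b)).

(** Energy of the motion along the axis if both binaries had shrunk to points;
    the actual long edges are longer, hence pull less. *)
Definition axial_energy {R : realType} (b kap x u : R) : R :=
  u ^+ 2 / 2 - 2 * kap * x `^ (- (2 * b)).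

Lemma axis_potential_le {R : realType} (b kap x y z : R) :
  0 <= b -> 0 <= kap -> 0 < x ->
  axis_potential b kap x y z <=
    kap * (y ^+ 2 + z ^+ 2) `^ (- b) + 2 * kap * x `^ (- (2 * b)).
Proof.
move=> b0 k0 x0.
have xE : x `^ (- (2 * b)) = (x ^+ 2) `^ (- b).
  by rewrite powR_sqr ?ltW// mulrN.
have x20 : 0 < x ^+ 2 by rewrite exprn_gt0.
have h1 : (x ^+ 2 + y ^+ 2) `^ (- b) <= (x ^+ 2) `^ (- b).
  by apply: ler_powRN; rewrite // lerDl sqr_ge0.
have h2 : (x ^+ 2 + z ^+ 2) `^ (- b) <= (x ^+ 2) `^ (- b).
  by apply: ler_powRN; rewrite // lerDl sqr_ge0.
by rewrite /axis_potential xE; nra.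
Qed.

(** The total energy is the axial energy, plus the energy of the binaries, plus
    a nonnegative rest (the long edges are longer than [x] suggests).  So an
    axial energy above [h + N] leaves at most [- N] to the binaries, and their
    potential must pay for it. *)
Lemma binary_kinetic_le {R : realType} (b kap h N x y z dx dy dz : R) :
  0 <= b -> 0 <= kap <= 1 -> 0 < x ->
  (dx ^+ 2 + dy ^+ 2 + dz ^+ 2) / 2 - axis_potential b kap x y z = h ->
  h + N <= axial_energy b kap x dx ->
  (dy ^+ 2 + dz ^+ 2) / 2 + N <= (y ^+ 2 + z ^+ 2) `^ (- b).
Proof.
move=> b0 /andP[k0 k1] x0 eh; rewrite /axial_energy => hN.
have := @axis_potential_le _ b kap x y z b0 k0 x0.
have := powR_ge0 (y ^+ 2 + z ^+ 2) (- b); nra.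
Qed.

Lemma cauchy_schwarz2 {R : realType} (y z dy dz : R) :
  (y * dy + z * dz) ^+ 2 <= (y ^+ 2 + z ^+ 2) * (dy ^+ 2 + dz ^+ 2).
Proof.
have := sqr_ge0 (y * dz - z * dy).
rewrite -subr_ge0 => e0; rewrite -subr_ge0; apply: (le_trans e0).
by rewrite le_eqVlt; apply/orP; left; apply/eqP; ring.
Qed.

(** Here [P = rho^(1-b)], so that [rho * rho' = P * v], and [W = rho^(-alpha)].
    The transverse part of [rho * rho'] is at most [(2 H + 18) P], because it is
    bounded by the size of the binaries times their speed, which stays moderate
    even when they are near collision ([b < 1]).  Whatever [v] exceeds
    [2 H + 18] by is therefore axial speed; the excess [2 (108 + H)] is chosen
    so that its kinetic energy covers [8 W] of axial potential, [H W >= |h|],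
    and still leaves [100 W]. *)
Lemma initial_bounds {R : realType} (b kap h H P x y z dx dy dz : R) :
  let s := x ^+ 2 + y ^+ 2 + z ^+ 2 in let W := s `^ (- b) in
  0 <= b <= 1 -> 0 <= kap <= 1 -> 0 < x -> 0 < y ^+ 2 + z ^+ 2 ->
  s <= 4 * x ^+ 2 -> `|h| <= H * W -> 0 < P -> P ^+ 2 = s * W ->
  (dx ^+ 2 + dy ^+ 2 + dz ^+ 2) / 2 - axis_potential b kap x y z = h ->
  P * (2 * H + 18 + 2 * (108 + H)) <= x * dx + y * dy + z * dz ->
  [/\ 0 < dx, 100 * W <= axial_energy b kap x dx &
      h + 100 * W <= axial_energy b kap x dx].
Proof.
move=> s W /andP[b0 b1] /andP[k0 k1] x0 e0 sx hH P0 P2 eh hA.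
set e := y ^+ 2 + z ^+ 2 in e0 *.
have x20 : 0 < x ^+ 2 by rewrite exprn_gt0.
have sE : s = x ^+ 2 + e by rewrite /s /e addrA.
have s0 : 0 < s by rewrite sE; lra.
have W0 : 0 < W by rewrite powR_gt0.
have H0 : 0 <= H by rewrite -(pmulr_lge0 _ W0) (le_trans _ hH).
have xE : x `^ (- (2 * b)) = (x ^+ 2) `^ (- b).
  by rewrite powR_sqr ?ltW// mulrN.
have xW : x `^ (- (2 * b)) <= 4 * W.
  rewrite xE; apply: (le_trans (y := (s / 4) `^ (- b))).
    by apply: ler_powRN => //; lra.
  by apply: powRN_div => //; [apply/andP|lra].
have xW0 : 0 <= x `^ (- (2 * b)) by rewrite powR_ge0.
have eW : e * e `^ (- b) <= s * W.
  rewrite /W !mulr_powRN//; apply: ge0_ler_powR; rewrite ?nnegrE; lra.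
have := @axis_potential_le _ b kap x y z b0 k0 x0.
rewrite -/e => Ule.
set k := dy ^+ 2 + dz ^+ 2.
have eb0 : 0 <= e `^ (- b) by rewrite powR_ge0.
have kle : k <= 2 * (H * W + e `^ (- b) + 2 * (4 * W)).
  have := ler_norm h; have := sqr_ge0 dx; rewrite /k; nra.
have ek : e * k <= (2 * H + 18) * P ^+ 2.
  have : e * k <= e * (2 * (H * W + e `^ (- b) + 2 * (4 * W))).
    by rewrite ler_pM2l.
  have : e * (H * W) <= s * (H * W).
    by apply: ler_wpM2r; [exact: mulr_ge0 H0 (ltW W0)|lra].
  have : e * W <= s * W by apply: ler_wpM2r; [exact: ltW|lra].
  by rewrite P2; lra.
have mle : y * dy + z * dz <= (2 * H + 18) * P.
  have := cauchy_schwarz2 y z dy dz; rewrite -/e -/k => cs.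
  have B0 : 0 <= (2 * H + 18) * P by apply: mulr_ge0; lra.
  rewrite -[leRHS]ger0_norm// (le_trans (ler_norm _))//.
  rewrite -ler_sqr ?nnegrE// !real_normK ?num_real//.
  apply: (le_trans cs); apply: (le_trans ek).
  by rewrite exprMn ler_wpM2r ?sqr_ge0//; nra.
have xdx : P * (2 * (108 + H)) <= x * dx by lra.
have dx0 : 0 < dx.
  have : 0 < x * dx by apply: lt_le_trans xdx; rewrite mulr_gt0//; lra.
  by rewrite pmulr_rgt0.
have dx2 : W * (2 * (108 + H)) ^+ 2 <= dx ^+ 2.
  rewrite -(ler_pM2l x20).
  apply: (le_trans (y := (P * (2 * (108 + H))) ^+ 2)).
    rewrite [leRHS]exprMn P2 mulrA; apply: ler_wpM2r; first exact: sqr_ge0.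
    by apply: ler_wpM2r; lra.
  have PH0 : 0 <= P * (2 * (108 + H)) by apply: mulr_ge0; lra.
  by rewrite -exprMn ler_sqr ?nnegrE// (le_trans PH0).
have WH : W * (2 * (108 + H)) <= W * (2 * (108 + H)) ^+ 2 / 2.
  rewrite -mulrA ler_pM2l//; nra.
have kx : kap * x `^ (- (2 * b)) <= 4 * W.
  by apply: le_trans xW; rewrite ler_piMl.
have HW0 : 0 <= H * W by rewrite mulr_ge0 // ltW.
have := ler_norm h.
by split => //; rewrite /axial_energy; lra.
Qed.

(** * Collision times are isolated *)

Section time_interval.
Context {R : realType} {S T : \bar R}.

Lemma inside_between a c t :
  (S < a%:E)%E -> (c%:E < T)%E -> a <= t <= c -> (S < t%:E < T)%E.
Proof.
move=> Sa cT /andP[at_ tc]; apply/andP; split.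
  by apply: (lt_le_trans Sa); rewrite lee_fin.
by apply: le_lt_trans cT; rewrite lee_fin.
Qed.

Lemma near_inside t : (S < t%:E < T)%E -> \forall s \near t, (S < s%:E < T)%E.
Proof.
move=> /andP[St tT].
suff H : (\forall s \near t, (S < s%:E)%E) /\ (\forall s \near t, (s%:E < T)%E).
  by case: H => H1 H2; near=> s; apply/andP; split; near: s.
split.
- case: S St => [r| |] //=; rewrite ?lte_fin => h0.
  + by near=> s; rewrite lte_fin; near: s; exact: lt_nbhsr.
  + by near=> s; rewrite ltNyr.
- case: T tT => [r| |] //=; rewrite ?lte_fin => h0.
  + by near=> s; rewrite lte_fin; near: s; exact: lt_nbhsl.
  + by near=> s; rewrite ltry.
Unshelve. all: by end_near. Qed.

Context {C : R -> Prop}.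
Context (finC : forall a c, (S < a%:E)%E -> (c%:E < T)%E ->
  finite_set [set t | a <= t <= c /\ C t]).

Lemma near_collision_free t : (S < t%:E < T)%E -> \forall s \near t, s != t -> ~ C s.
Proof.
move=> /near_inside /nbhs_ballP[e e0 He].
have e0' : 0 < e by exact: e0.
have St : (S < (t - e / 2)%:E)%E.
  have := He (t - e / 2); rewrite /ball /= => /(_ _)/andP[]// .
  by rewrite opprB addrC subrK ger0_norm; lra.
have tT : ((t + e / 2)%:E < T)%E.
  have := He (t + e / 2); rewrite /ball /= => /(_ _)/andP[]// .
  by rewrite opprD addrA subrr add0r normrN ger0_norm; lra.
have fin := finC _ _ St tT.
have : \forall s \near t, ~ ([set s | t - e / 2 <= s <= t + e / 2 /\ C s] `\ t) s.
  apply: open_nbhs_nbhs; split; last by move=> [_]; exact.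
  rewrite openC; apply: (@accessible_finite_set_closed R).1.
    exact/hausdorff_accessible/norm_hausdorff.
  exact: finite_setD.
move=> H; near=> s => /eqP st Cs.
have := near H s; apply => //; split => //; split => //.
apply/andP; split; near: s.
  by apply: lt_le_nbhsr; lra.
by apply: lt_le_nbhsl; lra.
Unshelve. all: by end_near. Qed.

Lemma near_collision_free_at t : (S < t%:E < T)%E -> ~ C t ->
  \forall s \near t, ~ C s.
Proof.
move=> /near_collision_free H Ct.
near=> s; have [->//|st] := eqVneq s t.
by move: st; near: s.
Unshelve. all: by end_near. Qed.

End time_interval.

(** * The axial velocity through collisions *)

Set Implicit Arguments.
Unset Strict Implicit.

(** What the scalar argument uses of an orbit: [x] is the coordinate along the
    axis of the binaries (with the sign that makes it positive initially),
    [y] and [z] are the other two, [C] is the set of collision times and [A] is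
    the continuous extension of [rho * rho'].  The force along the axis is only
    recorded through the two bounds that matter: it is attractive, and at most
    the force that derives from [axial_energy]. *)
Record axis_orbit {R : realType} (b h kap : R) (S T : \bar R)
    (x y z A : R -> R) (C : R -> Prop) : Prop := AxisOrbit {
  axis_x_continuous : forall t, (S < t%:E < T)%E -> {for t, continuous x};
  axis_y_continuous : forall t, (S < t%:E < T)%E -> {for t, continuous y};
  axis_z_continuous : forall t, (S < t%:E < T)%E -> {for t, continuous z};
  axis_A_continuous : forall t, (S < t%:E < T)%E -> {for t, continuous A};
  axis_finite : forall a c, (S < a%:E)%E -> (c%:E < T)%E ->
    finite_set [set t | a <= t <= c /\ C t];
  axis_collision : forall t, C t -> 0 < x t -> y t = 0 /\ z t = 0;
  axis_separated : forall t, ~ C t -> 0 < y t ^+ 2 + z t ^+ 2;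
  axis_derivable : forall t, (S < t%:E < T)%E -> ~ C t ->
    [/\ derivable x t 1, derivable y t 1, derivable z t 1 &
        derivable (derive1 x) t 1];
  axis_acceleration : forall t, (S < t%:E < T)%E -> ~ C t -> 0 < x t ->
    - (4 * b * kap * x t `^ (- (2 * b) - 1)) <= derive1 (derive1 x) t <= 0;
  axis_energy : forall t, (S < t%:E < T)%E -> ~ C t ->
    (derive1 x t ^+ 2 + derive1 y t ^+ 2 + derive1 z t ^+ 2) / 2 -
      axis_potential b kap (x t) (y t) (z t) = h;
  axis_A : forall t, (S < t%:E < T)%E -> ~ C t ->
    A t = x t * derive1 x t + y t * derive1 y t + z t * derive1 z t
}.

Unset Implicit Arguments.
Set Strict Implicit.

(** At a collision [y] and [z] vanish while their derivatives blow up; [0] is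
    the limit of the product. *)
Definition transverse_moment {R : realType} (y z : R -> R) (C : R -> Prop) (t : R) : R :=
  if `[< C t >] then 0 else y t * derive1 y t + z t * derive1 z t.

(** [x'] continued through collisions: away from them [A] is the sum of [x x']
    and the transverse moment. *)
Definition axial_velocity {R : realType} (x y z A : R -> R) (C : R -> Prop) (t : R) : R :=
  (A t - transverse_moment y z C t) / x t.

Section continuation.
Context {R : realType} {b h kap : R} {S T : \bar R} {x y z A : R -> R} {C : R -> Prop}.
Context (b01 : 0 < b < 1) (kap01 : 0 <= kap <= 1).
Context (O : axis_orbit b h kap S T x y z A C).

Let m := transverse_moment y z C.
Let u := axial_velocity x y z A C.
Let J t := axial_energy b kap (x t) (u t).

Lemma axial_velocityE t : (S < t%:E < T)%E -> ~ C t -> 0 < x t -> u t = derive1 x t.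
Proof.
move=> tST Ct x0; rewrite /u /axial_velocity /transverse_moment.
case: asboolP => // _; rewrite (axis_A O tST Ct).
by field; rewrite gt_eqF.
Qed.

(** By energy conservation the squared transverse speed is at most a constant
    plus [2 e^(-b)], where [e = y^2 + z^2]; multiplied by [e], every term of the
    bound has a positive power of [e]. *)
Lemma transverse_moment_sqr_le t : (S < t%:E < T)%E -> 0 < x t ->
  m t ^+ 2 <= 2 * `|h| * (y t ^+ 2 + z t ^+ 2)
    + 2 * (y t ^+ 2 + z t ^+ 2) `^ (1 - b)
    + 4 * (y t ^+ 2 + z t ^+ 2) * x t `^ (- (2 * b)).
Proof.
move=> tST x0; have /andP[b0 b1] := b01; have /andP[k0 k1] := kap01.
set e := y t ^+ 2 + z t ^+ 2.
have e0 : 0 <= e by rewrite addr_ge0 ?sqr_ge0.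
have xb0 : 0 <= x t `^ (- (2 * b)) by rewrite powR_ge0.
have hh := ler_norm h; have h0 := normr_ge0 h.
rewrite /m /transverse_moment; case: asboolP => [_|Ct].
  by rewrite expr0n /= !addr_ge0 ?mulr_ge0 ?powR_ge0.
have e0' := axis_separated O Ct; rewrite -/e in e0'.
apply: (le_trans (cauchy_schwarz2 _ _ _ _)); rewrite -/e -mulr_powRN//.
have := @axis_potential_le _ b kap (x t) (y t) (z t) (ltW b0) k0 x0.
have := axis_energy O tST Ct; rewrite -/e.
have eb0 : 0 <= e `^ (- b) by rewrite powR_ge0.
have := sqr_ge0 (derive1 x t).
set P := axis_potential _ _ _ _ _.
set k := derive1 y t ^+ 2 + derive1 z t ^+ 2 => q1 q2 q3.
have : k <= 2 * `|h| + 2 * e `^ (- b) + 4 * x t `^ (- (2 * b)).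
  by rewrite /k; nra.
by rewrite -(ler_pM2l e0'); lra.
Qed.

(** Away from collisions the transverse moment is [A - x x']; at a collision it
    is squeezed to [0] by [transverse_moment_sqr_le], as [1 - b > 0]. *)
Lemma transverse_moment_continuous t : (S < t%:E < T)%E -> 0 < x t ->
  {for t, continuous m}.
Proof.
move=> tST x0; have /andP[b0 b1] := b01.
have cx := axis_x_continuous O tST.
have cy := axis_y_continuous O tST.
have cz := axis_z_continuous O tST.
have [Ct|Ct] := pselect (C t); last first.
  have [dx _ _ ddx] := axis_derivable O tST Ct.
  have : (fun s => A s - x s * derive1 x s) s @[s --> t] --> A t - x t * derive1 x t.
    apply: cvgB; first exact: (axis_A_continuous O tST).
    by apply: cvgM; [exact: cx|exact: derivable_continuous_at].
  have mE s : (S < s%:E < T)%E -> ~ C s -> A s - x s * derive1 x s = m s.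
    move=> sST Cs; rewrite /m /transverse_moment (axis_A O sST Cs).
    by case: asboolP => // _; ring.
  rewrite (mE t tST Ct); apply: cvg_trans; apply: near_eq_cvg.
  near=> s; rewrite mE//; near: s; first exact: near_inside.
  exact: (near_collision_free_at (axis_finite O)).
have [yt zt] := axis_collision O Ct x0.
have mt : m t = 0 by rewrite /m /transverse_moment; case: asboolP.
have ce : y s ^+ 2 + z s ^+ 2 @[s --> t] --> (0 : R).
  have -> : 0 = y t ^+ 2 + z t ^+ 2 :> R by rewrite yt zt expr0n addr0.
  by apply: cvgD; apply: (@cvg_comp _ _ _ _ (fun r : R => r ^+ 2)); [exact: cy| |exact: cz|]; exact: exprn_continuous.
have cxb : x s `^ (- (2 * b)) @[s --> t] --> x t `^ (- (2 * b)).
  exact: (cvg_comp _ _ cx (powR_continuous (- (2 * b)) _ x0)).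
have cG : 2 * `|h| * (y s ^+ 2 + z s ^+ 2)
    + 2 * (y s ^+ 2 + z s ^+ 2) `^ (1 - b)
    + 4 * (y s ^+ 2 + z s ^+ 2) * x s `^ (- (2 * b)) @[s --> t] --> (0 : R).
  have -> : 0 = 2 * `|h| * 0 + 2 * 0 + 4 * 0 * x t `^ (- (2 * b)) :> R by ring.
  apply: cvgD; first apply: cvgD.
  - by apply: cvgM => //; exact: cvg_cst.
  - apply: cvgM; first exact: cvg_cst.
    apply: cvg_powR0 => //; first lra.
    by move=> s; rewrite addr_ge0 ?sqr_ge0.
  - by apply: cvgM => //; apply: cvgM => //; exact: cvg_cst.
suff : m s @[s --> t] --> m t by [].
rewrite mt; apply/cvgr0Pnorm_lt => eps eps0.
have e2 : 0 < eps ^+ 2 by rewrite exprn_gt0.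
have H := (cvgr0Pnorm_lt _).1 cG _ e2.
near=> s.
rewrite -ltr_sqr ?nnegrE// ?(ltW eps0)// real_normK ?num_real//.
have sST : (S < s%:E < T)%E by near: s; exact: near_inside.
have xs : 0 < x s by near: s; exact: (cvgr_gt _ cx).
apply: (le_lt_trans (transverse_moment_sqr_le _ sST xs)).
by apply: (le_lt_trans (ler_norm _)); near: s; exact: H.
Unshelve. all: by end_near. Qed.

Lemma axial_velocity_continuous t : (S < t%:E < T)%E -> 0 < x t ->
  {for t, continuous u}.
Proof.
move=> tST x0; rewrite /continuous_at /u /axial_velocity.
apply: cvgM.
  apply: cvgB; first exact: (axis_A_continuous O tST).
  exact: transverse_moment_continuous.
by apply: cvgV; [rewrite gt_eqF|exact: (axis_x_continuous O tST)].
Qed.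

Lemma axial_energy_continuous t : (S < t%:E < T)%E -> 0 < x t ->
  {for t, continuous J}.
Proof.
move=> tST x0; rewrite /continuous_at /J /axial_energy.
apply: cvgB.
  apply: cvgM; last exact: cvg_cst.
  apply: (@cvg_comp _ _ _ u (fun r : R => r ^+ 2)).
    exact: axial_velocity_continuous.
  exact: exprn_continuous.
apply: cvgM; first exact: cvg_cst.
exact: (cvg_comp _ _ (axis_x_continuous O tST) (powR_continuous (- (2 * b)) _ x0)).
Qed.

Lemma is_derive_axial_velocity t : (S < t%:E < T)%E -> ~ C t -> 0 < x t ->
  is_derive t 1 u (derive1 (derive1 x) t).
Proof.
move=> tST Ct x0; have [dx _ _ ddx] := axis_derivable O tST Ct.
have E : {near t, derive1 x =1 u}.
  near=> s; rewrite axial_velocityE//; near: s.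
  - exact: near_inside.
  - exact: (near_collision_free_at (axis_finite O)).
  - exact: (cvgr_gt _ (axis_x_continuous O tST)).
split; first exact: near_eq_derivable E ddx.
by rewrite derive1E; apply/esym/near_eq_derive.
Unshelve. all: by end_near. Qed.

(** The second factor is the excess of the axial force over the one deriving
    from [axial_energy], hence nonnegative: the axial energy grows as long as
    the binaries move apart. *)
Lemma is_derive_axial_energy t : (S < t%:E < T)%E -> ~ C t -> 0 < x t ->
  is_derive t 1 J (u t * (derive1 (derive1 x) t +
     4 * b * kap * x t `^ (- (2 * b) - 1))).
Proof.
move=> tST Ct x0; have [dx _ _ ddx] := axis_derivable O tST Ct.
have Du := is_derive_axial_velocity t tST Ct x0.
have Dx : is_derive t 1 x (u t).
  by rewrite axial_velocityE// derive1E; exact/derivableP.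
have Dp := is_derive1_comp (is_derive1_powR (- (2 * b)) x0) Dx.
rewrite /J /axial_energy.
have -> : (fun t => u t ^+ 2 / 2 - 2 * kap * x t `^ (- (2 * b))) =
   (fun t => u t ^+ 2 / 2) - (fun t => 2 * kap * ((fun r : R => r `^ (- (2 * b))) \o x) t) by [].
apply: is_derive_eq.
by rewrite /GRing.scale /=; field.
Qed.

End continuation.

(** * Escape along the axis *)

Section monotonicity.
Context {R : realType} {b h kap : R} {S T : \bar R} {x y z A : R -> R} {C : R -> Prop}.
Context (b01 : 0 < b < 1) (kap01 : 0 <= kap <= 1).
Context (O : axis_orbit b h kap S T x y z A C).

Let m := transverse_moment y z C.
Let u := axial_velocity x y z A C.
Let J t := axial_energy b kap (x t) (u t).

Lemma axial_monotone a c : (S < a%:E)%E -> (c%:E < T)%E -> a <= c ->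
  (forall t, a <= t <= c -> 0 < x t /\ 0 <= u t) ->
  x a <= x c /\ J a <= J c.
Proof.
move=> Sa cT ac pos; have fin := axis_finite O Sa cT.
have /andP[b0 b1] := b01; have /andP[k0 k1] := kap01.
have ins t : a <= t <= c -> (S < t%:E < T)%E by exact: inside_between.
have w t : a < t < c -> a <= t <= c by move=> /andP[h1 h2]; rewrite !ltW.
split; apply: (nondecreasing_off_finite _ _ _ _ fin ac).
- by move=> t /ins tST; exact: (axis_x_continuous O tST).
- move=> t /w tac Ct; have [x0 u0] := pos t tac.
  have [dx _ _ _] := axis_derivable O (ins t tac) Ct; split => //.
  by rewrite -(axial_velocityE O)//; exact: ins.
- move=> t tac; have [x0 u0] := pos t tac.
  by apply: (axial_energy_continuous b01 kap01 O) => //; exact: ins.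
- move=> t /w tac Ct; have [x0 u0] := pos t tac.
  have D := is_derive_axial_energy O t (ins t tac) Ct x0.
  split; first exact: ex_derive.
  have /andP[acc _] := axis_acceleration O (ins t tac) Ct x0.
  by rewrite derive1E derive_val mulr_ge0//; lra.
Qed.

Lemma axial_velocity_le a c : (S < a%:E)%E -> (c%:E < T)%E -> a <= c ->
  (forall t, a <= t <= c -> 0 < x t) -> u c <= u a.
Proof.
move=> Sa cT ac pos; have fin := axis_finite O Sa cT.
have ins t : a <= t <= c -> (S < t%:E < T)%E by exact: inside_between.
have w t : a < t < c -> a <= t <= c by move=> /andP[h1 h2]; rewrite !ltW.
suff : - u a <= - u c by rewrite lerN2.
apply: (nondecreasing_off_finite _ (- u) _ _ fin ac).
- move=> t tac; apply: continuousN.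
  by apply: (axial_velocity_continuous b01 kap01 O); [exact: ins|exact: pos].
- move=> t /w tac Ct.
  have D := is_derive_axial_velocity O t (ins t tac) Ct (pos t tac).
  split; first by apply: ex_derive.
  have /andP[_ acc] := axis_acceleration O (ins t tac) Ct (pos t tac).
  by rewrite derive1E derive_val; lra.
Qed.

Section escape.
Context {t1 : R} (t1ST : (S < t1%:E < T)%E).
Context (x1 : 0 < x t1) (u1 : 0 <= u t1) (J1 : 0 < J t1).

Lemma axial_energy_velocity t : 0 < J t -> 2 * J t <= u t ^+ 2.
Proof.
have /andP[k0 k1] := kap01; move=> J0.
have : 0 <= kap * x t `^ (- (2 * b)) by rewrite mulr_ge0 ?powR_ge0.
by rewrite /J /axial_energy; lra.
Qed.

(** The three inequalities sustain each other: while [x > 0] and [u >= 0], both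
    [x] and [J] grow, and [J > 0] keeps [u] away from [0]. *)
Lemma axial_escape t : t1 <= t -> (t%:E < T)%E ->
  [/\ x t1 <= x t, 0 <= u t & J t1 <= J t].
Proof.
move=> t1t tT; have /andP[St1 t1T] := t1ST.
pose P t := [/\ x t1 <= x t, 0 <= u t & J t1 <= J t].
apply: (@real_induction _ P t1 t); last by rewrite t1t lexx.
- move=> s sI H; have /andP[t1s st] := sI.
  have sST : (S < s%:E < T)%E by apply: inside_between sI.
  have [<-|ns] := eqVneq t1 s; first by [].
  have t1s' : t1 < s by rewrite lt_neqAle ns.
  have xs : x t1 <= x s.
    apply: (ge_at_left x t1 s _ t1s' (axis_x_continuous O sST)).
    by move=> r /H [].
  have xs0 : 0 < x s by apply: lt_le_trans xs.
  split => //.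
    apply: (ge_at_left u t1 s _ t1s'); last by move=> r /H [].
    exact: (axial_velocity_continuous b01 kap01 O).
  apply: (ge_at_left J t1 s _ t1s'); last by move=> r /H [].
  exact: (axial_energy_continuous b01 kap01 O).
- move=> s /andP[t1s st] [xs us Js].
  have sI : t1 <= s <= t by rewrite t1s ltW.
  have sST : (S < s%:E < T)%E by apply: inside_between sI.
  have /andP[Ss sT] := sST.
  have xs0 : 0 < x s by apply: lt_le_trans xs.
  have us0 : 0 < u s.
    rewrite lt_neqAle us andbT eq_sym; apply/eqP => u0.
    have := axial_energy_velocity s (lt_le_trans J1 Js).
    by rewrite u0 expr0n /=; move: (lt_le_trans J1 Js); lra.
  have cus : u r @[r --> s] --> u s.
    exact: (axial_velocity_continuous b01 kap01 O _ sST xs0).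
  have : \forall r \near s, [/\ 0 < x r, 0 < u r & (r%:E < T)%E].
    near=> r; split; near: r.
    + exact: (cvgr_gt _ (axis_x_continuous O sST)).
    + exact: (cvgr_gt _ cus).
    + by apply: filterS (near_inside _ sST) => r /andP[].
  move=> /nbhs_ballP[e e0 He]; near=> r.
  have sr : s < r by near: r; exact: nbhs_right_gt.
  have rse : r < s + e by near: r; apply: nbhs_right_lt; rewrite ltrDl.
  have inb q : s <= q <= r -> ball s e q.
    by move=> /andP[h1 h2]; rewrite /ball /= distrC ger0_norm; lra.
  have srr : s <= r <= r by rewrite lexx andbT ltW.
  have [_ ur rT] := He r (inb r srr).
  have [|h1 h2] := axial_monotone s r Ss rT (ltW sr).
    by move=> q /inb /He [? /ltW ? _].
  by split; [exact: le_trans xs h1|exact: ltW|exact: le_trans Js h2].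
Unshelve. all: by end_near. Qed.

Lemma axial_position_ge t : t1 <= t -> (t%:E < T)%E ->
  x t1 + Num.sqrt (2 * J t1) * (t - t1) <= x t.
Proof.
move=> t1t tT; have /andP[St1 t1T] := t1ST.
have fin := axis_finite O St1 tT.
have ins s : t1 <= s <= t -> (S < s%:E < T)%E by exact: inside_between.
have w s : t1 < s < t -> t1 <= s <= t by move=> /andP[h1 h2]; rewrite !ltW.
pose k := Num.sqrt (2 * J t1).
suff : x t1 - k * t1 <= x t - k * t by rewrite -/k; lra.
apply: (nondecreasing_off_finite _ (fun s => x s - k * s) _ _ fin t1t).
- move=> s /ins sST; apply: continuousB; first exact: (axis_x_continuous O sST).
  by apply: continuousM; [exact: cst_continuous|exact: cvg_id].
- move=> s /w sI Cs; have sST := ins s sI; have /andP[Ss sT] := sST.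
  have /andP[t1s st] := sI.
  have [xs us Js] := axial_escape s t1s sT.
  have xs0 : 0 < x s by apply: lt_le_trans xs.
  have Dx : is_derive s 1 x (u s).
    have -> : u s = derive1 x s by exact: (axial_velocityE O).
    rewrite derive1E; apply: derivableP.
    by have [] := axis_derivable O sST Cs.
  have D : is_derive s 1 (fun s => x s - k * s) (u s - k).
    by apply: is_derive_eq; rewrite /GRing.scale /=; ring.
  split; first exact: ex_derive.
  rewrite derive1E derive_val subr_ge0 /k.
  rewrite -[leRHS]ger0_norm// -sqrtr_sqr ler_wsqrtr//.
  apply: le_trans (axial_energy_velocity s (lt_le_trans J1 Js)).
  by rewrite ler_pM2l.
Qed.

End escape.
End monotonicity.

(** * The binaries stay tight *)

Section binaries.
Context {R : realType} {b h kap : R} {S T : \bar R} {x y z A : R -> R} {C : R -> Prop}.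
Context (b01 : 0 < b < 1) (kap01 : 0 <= kap <= 1).
Context (O : axis_orbit b h kap S T x y z A C).

Let m := transverse_moment y z C.
Let u := axial_velocity x y z A C.
Let J t := axial_energy b kap (x t) (u t).
Let e t := y t ^+ 2 + z t ^+ 2.
Let k t := derive1 y t ^+ 2 + derive1 z t ^+ 2.
Let r2 t := x t ^+ 2 + y t ^+ 2 + z t ^+ 2.

Context {t1 : R} (t1ST : (S < t1%:E < T)%E).
Let W := r2 t1 `^ (- b).
Context (x1 : 0 < x t1) (u1 : 0 <= u t1) (r1 : r2 t1 <= 4 * x t1 ^+ 2).
Context (J1 : 100 * W <= J t1) (hJ1 : h + 100 * W <= J t1).

Let r2_gt0 : 0 < r2 t1.
Proof. by rewrite /r2 -addrA ltr_pwDl ?exprn_gt0// addr_ge0 ?sqr_ge0. Qed.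

Let W_gt0 : 0 < W.
Proof. by rewrite powR_gt0. Qed.

Let J_gt0 : 0 < J t1.
Proof. by apply: lt_le_trans J1; rewrite mulr_gt0. Qed.

Let escape t : t1 <= t -> (t%:E < T)%E ->
  [/\ x t1 <= x t, 0 <= u t & J t1 <= J t].
Proof. exact: (axial_escape b01 kap01 O t1ST x1 u1 J_gt0). Qed.

Let x_gt0 t : t1 <= t -> (t%:E < T)%E -> 0 < x t.
Proof. by move=> t1t tT; have [+ _ _] := escape t t1t tT; exact: lt_le_trans. Qed.

Let inside t : t1 <= t -> (t%:E < T)%E -> (S < t%:E < T)%E.
Proof.
move=> t1t tT; rewrite tT andbT.
by apply: lt_le_trans (_ : (t1%:E <= _)%E); [case/andP: t1ST|rewrite lee_fin].
Qed.

Lemma transverse_kinetic_le t : t1 <= t -> (t%:E < T)%E -> ~ C t ->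
  k t / 2 + 100 * W <= e t `^ (- b).
Proof.
move=> t1t tT Ct; have /andP[b0 b1] := b01.
have [_ _ Jt] := escape t t1t tT.
apply: (@binary_kinetic_le _ b kap h (100 * W) (x t) (y t) (z t) (derive1 x t)) => //.
- exact: ltW.
- exact: x_gt0.
- by apply: (axis_energy O) => //; exact: inside.
- have <- : u t = derive1 x t by apply: (axial_velocityE O) => //; [exact: inside|exact: x_gt0].
  exact: le_trans Jt.
Qed.

Lemma transverse_collision t : t1 <= t -> (t%:E < T)%E -> C t -> e t = 0.
Proof.
move=> t1t tT Ct; have [yt zt] := axis_collision O Ct (x_gt0 t t1t tT).
by rewrite /e yt zt expr0n addr0.
Qed.

(** The binding energy [100 W] is that of a much smaller separation than
    [rho] at the time [t1]. *)
Lemma transverse_bound t : t1 <= t -> (t%:E < T)%E -> 16 * e t <= r2 t1.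
Proof.
move=> t1t tT; have /andP[b0 b1] := b01.
have [Ct|Ct] := pselect (C t).
  by rewrite (transverse_collision t t1t tT Ct) mulr0 ltW.
have := transverse_kinetic_le t t1t tT Ct.
have k0 : 0 <= k t by rewrite addr_ge0 ?sqr_ge0.
move=> kle; rewrite leNgt; apply/negP => lt.
have : e t `^ (- b) <= (r2 t1 / 16) `^ (- b).
  by apply: ler_powRN; [exact: ltW|rewrite divr_gt0|lra].
have : (r2 t1 / 16) `^ (- b) <= 16 * W.
  by apply: powRN_div => //; [rewrite !ltW|lra].
move: W_gt0; lra.
Qed.

Lemma transverse_le_axial t : t1 <= t -> (t%:E < T)%E -> 4 * e t <= x t ^+ 2.
Proof.
move=> t1t tT; have := transverse_bound t t1t tT.
have [xt _ _] := escape t t1t tT.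
have : x t1 ^+ 2 <= x t ^+ 2.
  by rewrite ler_sqr ?nnegrE ?(ltW x1) ?(ltW (x_gt0 t t1t tT)).
move: r1; lra.
Qed.

Lemma transverse_moment_bound t : t1 <= t -> (t%:E < T)%E ->
  m t ^+ 2 <= 2 * (r2 t1 * W).
Proof.
move=> t1t tT; have /andP[b0 b1] := b01.
have rW : 0 <= r2 t1 * W by rewrite mulr_ge0// ltW.
rewrite /m /transverse_moment; case: asboolP => Ct.
  by rewrite expr0n /= mulr_ge0.
apply: (le_trans (cauchy_schwarz2 _ _ _ _)); rewrite -/(e t) -/(k t).
have e0 := axis_separated O Ct; rewrite -/(e t) in e0.
have kle := transverse_kinetic_le t t1t tT Ct.
apply: (le_trans (y := e t * (2 * e t `^ (- b)))).
  by rewrite ler_pM2l//; move: W_gt0; lra.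
rewrite mulrCA ler_pM2l// /W !mulr_powRN//.
apply: ge0_ler_powR; rewrite ?nnegrE; have := transverse_bound t t1t tT; lra.
Qed.

Let is_derive_e t : (S < t%:E < T)%E -> ~ C t -> is_derive t 1 e (2 * m t).
Proof.
move=> tST Ct; have [_ dy dz _] := axis_derivable O tST Ct.
have Dy := is_derive_sqr y t dy; have Dz := is_derive_sqr z t dz.
apply: is_derive_eq; rewrite /m /transverse_moment.
by case: asboolP => // _; ring.
Qed.

Let e_continuous t : (S < t%:E < T)%E -> {for t, continuous e}.
Proof.
move=> tST; apply: continuousD; apply: sqr_continuous.
  exact: (axis_y_continuous O).
exact: (axis_z_continuous O).
Qed.

(** [rho * rho'] is [x u] plus the transverse moment; the square of the former
    is at least [50 rho^2 W] at the time [t1], that of the latter at most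
    [2 rho^2 W]. *)
Lemma radius_increasing t t' : t1 <= t -> t < t' -> (t'%:E < T)%E -> r2 t < r2 t'.
Proof.
move=> t1t tt' t'T.
have St : (S < t%:E)%E.
  have tT : (t%:E < T)%E by apply: lt_trans t'T; rewrite lte_fin.
  by have /andP[] := inside t t1t tT.
have fin := axis_finite O St t'T.
have mid s : t <= s <= t' -> t1 <= s /\ (s%:E < T)%E.
  move=> /andP[h1 h2]; split; first exact: le_trans h1.
  by apply: le_lt_trans t'T; rewrite lee_fin.
have w s : t < s < t' -> t <= s <= t' by move=> /andP[h1 h2]; rewrite !ltW.
apply: (increasing_off_finite false _ r2 t t' fin tt').
- move=> s /mid[t1s sT]; have sST := inside s t1s sT.
  apply: continuousD; last exact/sqr_continuous/(axis_z_continuous O).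
  apply: continuousD; apply/sqr_continuous; first exact: (axis_x_continuous O).
  exact: (axis_y_continuous O).
- move=> s /w /mid[t1s sT] Cs; have sST := inside s t1s sT.
  have [dx dy dz _] := axis_derivable O sST Cs.
  have Dx := is_derive_sqr x s dx.
  have De := is_derive_e s sST Cs.
  have -> : r2 = (fun s => x s ^+ 2 + e s).
    by apply/funext => q; rewrite /r2 /e addrA.
  split; first exact: ex_derive.
  rewrite derive1E derive_val /=.
  have xs := x_gt0 s t1s sT.
  have <- : u s = derive1 x s by exact: (axial_velocityE O).
  have [xs1 us Js] := escape s t1s sT.
  have mle := transverse_moment_bound s t1s sT.
  have uge : 200 * W <= u s ^+ 2.
    have := axial_energy_velocity kap01 s (lt_le_trans J_gt0 Js).
    rewrite -/u -/(J s) => hJ; move: J1; lra.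
  have x2 : x t1 ^+ 2 <= x s ^+ 2.
    by rewrite ler_sqr ?nnegrE ?(ltW x1) ?(ltW xs).
  have lt2 : m s ^+ 2 < (x s * u s) ^+ 2.
    rewrite exprMn; apply: (le_lt_trans mle).
    apply: (lt_le_trans (y := x s ^+ 2 * (200 * W))); last first.
      by rewrite ler_pM2l ?exprn_gt0.
    have : r2 t1 * W <= 4 * x s ^+ 2 * W.
      by rewrite ler_pM2r //; move: r1; lra.
    have : 0 < x s ^+ 2 * W by rewrite mulr_gt0 ?exprn_gt0.
    lra.
  have xu0 : 0 <= x s * u s by rewrite mulr_ge0// ltW.
  have : `|m s| < x s * u s.
    by rewrite -ltr_sqr ?nnegrE// real_normK ?num_real.
  by rewrite ltr_norml => /andP[]; lra.
Qed.

Section finite_time.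
Context {c : R} (Tc : T = c%:E).

Let t1c : t1 < c.
Proof. by move: t1ST; rewrite Tc lte_fin => /andP[]. Qed.

Let ltc t : t < c -> (t%:E < T)%E.
Proof. by rewrite Tc lte_fin. Qed.

(** [0 <= x'] and, the force being attractive, [x' <= u t1]. *)
Lemma axial_cvg : cvg (x t @[t --> c^'-]).
Proof.
apply: (cvg_at_left_lipschitz x t1 c (u t1) t1c) => s t t1s st /ltc tT.
have /andP[St1 _] := t1ST.
have mid q : s <= q <= t -> t1 <= q /\ (q%:E < T)%E.
  move=> /andP[h1 h2]; split; first exact: le_trans h1.
  by apply: le_lt_trans tT; rewrite lee_fin.
have w q : s < q < t -> s <= q <= t by move=> /andP[h1 h2]; rewrite !ltW.
have Ss : (S < s%:E)%E by apply: lt_le_trans St1 _; rewrite lee_fin.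
apply: (lipschitz_off_finite _ x _ _ _ (axis_finite O Ss tT) st).
  by move=> q /mid[t1q qT]; exact: (axis_x_continuous O (inside q t1q qT)).
move=> q /w /mid[t1q qT] Cq; have qST := inside q t1q qT.
have [dx _ _ _] := axis_derivable O qST Cq; split => //.
have [xq uq _] := escape q t1q qT.
have <- : u q = derive1 x q by apply: (axial_velocityE O) => //; exact: x_gt0.
rewrite ger0_norm//; apply: (axial_velocity_le b01 kap01 O) => // p /andP[h1 h2].
apply: x_gt0 => //.
by apply: le_lt_trans qT; rewrite lee_fin.
Qed.

(** The derivative of [y^2 + z^2] is twice the transverse moment, which is
    bounded although the velocities are not: this controls the binaries even if
    collisions accumulate at the end time. *)
Let e_cvg : cvg (e t @[t --> c^'-]).
Proof.
set M := 2 * (r2 t1 * W) + 1.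
apply: (cvg_at_left_lipschitz e t1 c (2 * M) t1c) => s t t1s st /ltc tT.
have /andP[St1 _] := t1ST.
have mid q : s <= q <= t -> t1 <= q /\ (q%:E < T)%E.
  move=> /andP[h1 h2]; split; first exact: le_trans h1.
  by apply: le_lt_trans tT; rewrite lee_fin.
have w q : s < q < t -> s <= q <= t by move=> /andP[h1 h2]; rewrite !ltW.
have Ss : (S < s%:E)%E by apply: lt_le_trans St1 _; rewrite lee_fin.
apply: (lipschitz_off_finite _ e _ _ _ (axis_finite O Ss tT) st).
  by move=> q /mid[t1q qT]; exact: (e_continuous q (inside q t1q qT)).
move=> q /w /mid[t1q qT] Cq; have qST := inside q t1q qT.
have De := is_derive_e q qST Cq; split; first exact: ex_derive.
rewrite derive1E derive_val normrM ger0_norm// ler_pM2l//.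
have rW : 0 <= r2 t1 * W by rewrite mulr_ge0// ltW.
have M0 : 0 <= M by rewrite /M; lra.
(* w <= (w + 1)^2 for w >= 0, which is why [M] has the extra 1. *)
rewrite -ler_sqr ?nnegrE// real_normK ?num_real//.
apply: (le_trans (transverse_moment_bound q t1q qT)); rewrite /M; nra.
Qed.

(** If [y^2 + z^2] tends to [0], so does [f]; otherwise the binaries stay away
    from collision near the end time, so their velocities are bounded. *)
Lemma transverse_cvg (f : R -> R) :
  (forall t, (S < t%:E < T)%E -> {for t, continuous f}) ->
  (forall t, (S < t%:E < T)%E -> ~ C t -> derivable f t 1) ->
  (forall t, f t ^+ 2 <= e t) ->
  (forall t, derive1 f t ^+ 2 <= k t) ->
  cvg (f t @[t --> c^'-]).
Proof.
move=> cf df fe fk; have /andP[b0 b1] := b01.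
have /cvg_ex[/= l el] := e_cvg.
have l0 : 0 <= l.
  apply: (cvgr_to_ge el); apply: nearW => t.
  by rewrite /e addr_ge0 ?sqr_ge0.
have [l00|ln0] := eqVneq l 0.
  apply/cvg_ex; exists 0; apply/cvgr0Pnorm_lt => eps eps0.
  have e2 : 0 < eps ^+ 2 by rewrite exprn_gt0.
  rewrite l00 in el; have H := (cvgr0Pnorm_lt _).1 el _ e2.
  near=> t; rewrite -ltr_sqr ?nnegrE// ?(ltW eps0)// real_normK ?num_real//.
  apply: (le_lt_trans (fe t)); apply: (le_lt_trans (ler_norm _)).
  by near: t; exact: H.
have lpos : 0 < l by rewrite lt_neqAle eq_sym ln0.
have : \forall t \near c^'-, l / 2 < e t.
  by apply: (cvgr_gt _ el); lra.
rewrite /at_left /within /= => /nbhs_ballP[d d0 Hd].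
have d0' : 0 < d by exact: d0.
pose a := Num.max t1 (c - d / 2).
have t1a : t1 <= a by rewrite /a le_max lexx.
have ac : a < c by rewrite /a gt_max t1c; lra.
have ea t : a <= t -> t < c -> l / 2 < e t.
  move=> + tc; rewrite /a ge_max => /andP[h1 h2]; apply: Hd => //.
  by rewrite /ball /= ger0_norm; lra.
set M := 2 * (l / 2) `^ (- b) + 1.
apply: (cvg_at_left_lipschitz f a c M ac) => s t as_ st tc.
have tT := ltc t tc.
have /andP[St1 _] := t1ST.
have t1s := le_trans t1a as_.
have mid q : s <= q <= t -> [/\ a <= q, q < c, t1 <= q & (q%:E < T)%E].
  move=> /andP[h1 h2]; have qc := le_lt_trans h2 tc.
  by split; rewrite ?(le_trans _ h1)//; exact: ltc.
have w q : s < q < t -> s <= q <= t by move=> /andP[h1 h2]; rewrite !ltW.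
have Ss : (S < s%:E)%E by apply: lt_le_trans St1 _; rewrite lee_fin.
apply: (lipschitz_off_finite _ f _ _ _ (axis_finite O Ss tT) st).
  by move=> q /mid[_ _ t1q qT]; exact: (cf q (inside q t1q qT)).
move=> q /w /mid[aq qc t1q qT] Cq; have qST := inside q t1q qT.
split; first exact: df.
have kle := transverse_kinetic_le q t1q qT Cq.
have ele : e q `^ (- b) <= (l / 2) `^ (- b).
  by apply: ler_powRN; [exact: ltW|lra|exact/ltW/ea].
have p0 : 0 <= (l / 2) `^ (- b) by rewrite powR_ge0.
have M0 : 0 <= M by rewrite /M; lra.
rewrite -ler_sqr ?nnegrE// real_normK ?num_real//.
apply: (le_trans (fk q)); move: W_gt0; rewrite /M; nra.
Unshelve. all: by end_near. Qed.

Lemma position_cvg : [/\ cvg (x t @[t --> c^'-]), cvg (y t @[t --> c^'-])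
  & cvg (z t @[t --> c^'-])].
Proof.
split; first exact: axial_cvg.
- apply: transverse_cvg.
  + by move=> t; exact: (axis_y_continuous O).
  + by move=> t tST Ct; have [] := axis_derivable O tST Ct.
  + by move=> t; rewrite /e lerDl sqr_ge0.
  + by move=> t; rewrite /k lerDl sqr_ge0.
- apply: transverse_cvg.
  + by move=> t; exact: (axis_z_continuous O).
  + by move=> t tST Ct; have [] := axis_derivable O tST Ct.
  + by move=> t; rewrite /e lerDr sqr_ge0.
  + by move=> t; rewrite /k lerDr sqr_ge0.
Qed.

End finite_time.
End binaries.

(** * Geometry of the dihedral configurations *)

(** Arithmetic of ['I_3] is modulo 3, so [k], [k + 1] and [k + 1 + 1] are the three
    coordinate axes for every [k]: no axis has to be singled out. *)
Section axes.
Implicit Types k l : 'I_3.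

Lemma axis3 k : k + 1 + 1 + 1 = k.
Proof. by case: k => [[|[|[|]]]] // ?; apply: val_inj. Qed.

Lemma axis_cases k l : [|| l == k, l == k + 1 | l == k + 1 + 1].
Proof. by case: k => [[|[|[|]]]] // ?; case: l => [[|[|[|]]]]. Qed.

Lemma axis_neq k : ((k + 1 == k) = false) * ((k + 1 + 1 == k) = false) *
  ((k == k + 1) = false) * ((k == k + 1 + 1) = false) *
  ((k + 1 == k + 1 + 1) = false) * ((k + 1 + 1 == k + 1) = false).
Proof. by case: k => [[|[|[|]]]]. Qed.

Lemma sum_axes {V : nmodType} (f : 'I_3 -> V) k :
  \sum_l f l = f k + f (k + 1) + f (k + 1 + 1).
Proof.
rewrite (bigD1 k)//= (bigD1 (k + 1)) ?axis_neq//= (bigD1 (k + 1 + 1)) ?axis_neq//=.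
rewrite big1 ?addr0 ?addrA// => l; have := axis_cases k l.
by case: eqP => //; case: eqP => //; case: eqP.
Qed.

End axes.

Section configurations.
Context {R : realType}.
Implicit Types (q : 'rV[R]_3) (k : 'I_3).

Lemma bodyE q g l : body q g 0 l =
  if g is Some k then (if l == k then q 0 l else - q 0 l) else q 0 l.
Proof.
rewrite /body /D2mx; case: g => [k|]; last by rewrite mulmx1.
by rewrite mul_mx_diag !mxE; case: ifP; rewrite ?mulr1 ?mulrN1.
Qed.

Lemma dotE x y k : dot x y = x 0 k * y 0 k + x 0 (k + 1) * y 0 (k + 1) +
  x 0 (k + 1 + 1) * y 0 (k + 1 + 1) :> R.
Proof. exact: sum_axes. Qed.

Lemma dot_ge0 (x : 'rV[R]_3) : 0 <= dot x x.
Proof. by apply: sumr_ge0 => l _; rewrite -expr2 sqr_ge0. Qed.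

Lemma rowBE (x y : 'rV[R]_3) l : (x - y) 0 l = x 0 l - y 0 l.
Proof. by rewrite !mxE. Qed.

Lemma edge_rotation q k :
  edge q None (Some k) = Num.sqrt (4 * (q 0 (k + 1) ^+ 2 + q 0 (k + 1 + 1) ^+ 2)).
Proof.
by rewrite /edge /enorm (dotE _ _ k) !rowBE !bodyE eqxx !axis_neq; congr Num.sqrt; ring.
Qed.

Lemma edgeC q g g' : edge q g g' = edge q g' g.
Proof.
by rewrite /edge /enorm !(dotE _ _ 0) !rowBE; congr Num.sqrt; ring.
Qed.

Lemma edge_rotations q k :
  edge q (Some k) (Some (k + 1)) = Num.sqrt (4 * (q 0 k ^+ 2 + q 0 (k + 1) ^+ 2)).
Proof.
by rewrite /edge /enorm (dotE _ _ k) !rowBE !bodyE !eqxx !axis_neq; congr Num.sqrt; ring.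
Qed.

Lemma collision_on_axis q k :
  q 0 (k + 1) = 0 -> q 0 (k + 1 + 1) = 0 -> collision q.
Proof.
move=> q1 q2; exists None, (Some k); split => //; apply/rowP => l.
rewrite !bodyE; case: eqP => // /eqP; have := axis_cases k l.
by case: (l == k) => //= /orP[] /eqP -> _; rewrite ?q1 ?q2 oppr0.
Qed.

(** Two bodies coincide only if some coordinate vanishes for each sign in which
    they differ; two distinct elements of the group differ in exactly two
    signs. *)
Lemma collision_off_axis q k : q 0 k != 0 ->
  collision q -> q 0 (k + 1) = 0 /\ q 0 (k + 1 + 1) = 0.
Proof.
move=> qk0 [g [g' [gg' /rowP E]]].
have o (r : R) : r = - r -> r = 0 by lra.
have o' (r : R) : - r = r -> r = 0 by lra.
have := (E k, E (k + 1), E (k + 1 + 1)); rewrite !bodyE => -[[]].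
have cas l : [\/ l = k, l = k + 1 | l = k + 1 + 1].
  by have /or3P[/eqP|/eqP|/eqP] := axis_cases k l; [constructor 1|constructor 2|constructor 3].
case: g gg' {E} => [l|]; case: g' => [l'|] //.
- case: (cas l) => ->; case: (cas l') => ->; rewrite !(eqxx, axis_neq) //= => _;
    try (by move=> /o qk; rewrite qk eqxx in qk0); try (by move=> /o' qk; rewrite qk eqxx in qk0).
    by move=> _ /o -> /o' ->.
  by move=> _ /o' -> /o ->.
- case: (cas l) => -> _; rewrite !(eqxx, axis_neq); try by move=> /o' qk; rewrite qk eqxx in qk0.
  by move=> _ /o' -> /o' ->.
- case: (cas l') => -> _; rewrite !(eqxx, axis_neq); try by move=> /o qk; rewrite qk eqxx in qk0.
  by move=> _ /o -> /o ->.
Qed.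

Lemma powR_sqrt (a p : R) : 0 <= a -> Num.sqrt a `^ (- p) = a `^ (- (p / 2)).
Proof. by move=> a0; rewrite -powR12_sqrt// -powRrM; congr (_ `^ _); field. Qed.

Lemma potentialE alpha q k : potential alpha q =
  axis_potential (alpha / 2) (4 `^ (- (alpha / 2)))
    (q 0 k) (q 0 (k + 1)) (q 0 (k + 1 + 1)).
Proof.
rewrite /potential (reindex_onto Some (odflt 0)) /=; last by case.
under eq_bigl do rewrite eqxx.
rewrite (eq_bigr (fun l => 4 `^ (- (alpha / 2)) *
   (q 0 (l + 1) ^+ 2 + q 0 (l + 1 + 1) ^+ 2) `^ (- (alpha / 2)))); last first.
  move=> l _; have -> : enorm (q - body q (Some l)) = edge q None (Some l).
    by rewrite /edge /body /= mulmx1.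
  have e0 : 0 <= q 0 (l + 1) ^+ 2 + q 0 (l + 1 + 1) ^+ 2 by rewrite addr_ge0 ?sqr_ge0.
  by rewrite edge_rotation powR_sqrt ?mulr_ge0// powRM.
rewrite (sum_axes _ k) !axis3 -!mulrDr; congr (_ * _).
rewrite addrAC; congr (_ + _).
by congr (_ `^ _); rewrite addrC.
Qed.

Lemma enorm_sqr (x : 'rV[R]_3) k :
  enorm x ^+ 2 = x 0 k ^+ 2 + x 0 (k + 1) ^+ 2 + x 0 (k + 1 + 1) ^+ 2.
Proof. by rewrite sqr_sqrtr ?dot_ge0// (dotE _ _ k) !expr2. Qed.

Lemma shortest_pair_axis q k :
  q 0 (k + 1) ^+ 2 < q 0 k ^+ 2 -> q 0 (k + 1 + 1) ^+ 2 < q 0 k ^+ 2 ->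
  shortest_pair q None (Some k) (Some (k + 1)) (Some (k + 1 + 1)).
Proof.
set a := q 0 k ^+ 2; set b := q 0 (k + 1) ^+ 2; set c := q 0 (k + 1 + 1) ^+ 2.
move=> ba ca.
have lt s t : s < t -> 0 < t -> Num.sqrt (4 * s) < Num.sqrt (4 * t) :> R.
  by move=> st t0; rewrite ltr_sqrt ?mulr_gt0// ltr_pM2l.
have b0 : 0 <= b by exact: sqr_ge0.
have c0 : 0 <= c by exact: sqr_ge0.
have ab : Num.sqrt (4 * (b + c)) < Num.sqrt (4 * (a + b)) by apply: lt; lra.
have ac : Num.sqrt (4 * (b + c)) < Num.sqrt (4 * (c + a)) by apply: lt; lra.
have E1 := edge_rotation q (k + 1).
have E2 := edge_rotation q (k + 1 + 1).
have E5 := edge_rotations q (k + 1 + 1).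
rewrite !axis3 in E1 E2 E5; rewrite edgeC in E5.
move=> g g'; rewrite !inE edge_rotation (edge_rotations q (k + 1)).
move=> /orP[]/eqP-> /orP[]/eqP->.
- by rewrite E1.
- by rewrite E2.
- by rewrite edge_rotations.
- by rewrite E5.
Qed.

End configurations.

(** * Reduction to the scalar system *)

Lemma derive_along {R : realType} {V W : normedModType R} (f : V -> W) (a v : V) :
  'D_v f a = 'D_1 (fun s : R => f (s *: v + a)) 0.
Proof.
rewrite /derive; apply: (f_equal (fun g : R -> W => lim (g @ (0 : R)^'))).
apply/funext => s /=.
by rewrite scale0r add0r addr0 [s *: 1]mulr1.
Qed.

Lemma is_derive_axis_potential {R : realType} (b kap x y z : R) :
  0 < x ^+ 2 + y ^+ 2 -> 0 < x ^+ 2 + z ^+ 2 ->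
  is_derive (0 : R) (1 : R) (fun s => axis_potential b kap (s + x) y z)
    (- (2 * b * kap * x * ((x ^+ 2 + y ^+ 2) `^ (- b - 1) +
                           (x ^+ 2 + z ^+ 2) `^ (- b - 1)))).
Proof.
move=> xy0 xz0.
have D c : 0 < x ^+ 2 + c ^+ 2 ->
  is_derive (0 : R) (1 : R) ((fun r : R => r `^ (- b)) \o (fun s => (s + x) ^+ 2 + c ^+ 2))
    (- b * (x ^+ 2 + c ^+ 2) `^ (- b - 1) * (2 * x)).
  move=> c0; apply: is_derive1_comp.
    by rewrite add0r; exact: is_derive1_powR.
  by apply: is_derive_eq; rewrite /GRing.scale /= add0r; ring.
have Dy := D y xy0; have Dz := D z xz0.
have -> : (fun s => axis_potential b kap (s + x) y z) =
  (fun s => kap * ((y ^+ 2 + z ^+ 2) `^ (- b) +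
    ((fun r : R => r `^ (- b)) \o (fun s => (s + x) ^+ 2 + y ^+ 2)) s +
    ((fun r : R => r `^ (- b)) \o (fun s => (s + x) ^+ 2 + z ^+ 2)) s)) by [].
by apply: is_derive_eq; rewrite /GRing.scale /=; ring.
Qed.

(** The long edges have lengths at least [2 x]. *)
Lemma axis_force_bounds {R : realType} (b kap x y z : R) :
  0 <= b -> 0 <= kap -> 0 < x ->
  - (4 * b * kap * x `^ (- (2 * b) - 1)) <=
  - (2 * b * kap * x * ((x ^+ 2 + y ^+ 2) `^ (- b - 1) +
                           (x ^+ 2 + z ^+ 2) `^ (- b - 1))) <= 0.
Proof.
move=> b0 k0 x0.
have H c : 0 <= (x ^+ 2 + c ^+ 2) `^ (- b - 1) <= (x ^+ 2) `^ (- b - 1).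
  rewrite powR_ge0 -opprD /=; apply: ler_powRN; rewrite ?exprn_gt0//; first lra.
  by rewrite lerDl sqr_ge0.
have /andP[y0 yl] := H y; have /andP[z0 zl] := H z.
have bk0 : 0 <= b * kap * x by rewrite !mulr_ge0// ltW.
have -> : x `^ (- (2 * b) - 1) = x * (x ^+ 2) `^ (- b - 1).
  rewrite powR_sqr ?ltW// -{2}[x]powRr1 ?ltW// -powRD; last by rewrite (gt_eqF x0) implybT.
  by congr (_ `^ _); ring.
set Y := (x ^+ 2 + y ^+ 2) `^ _ in y0 yl *.
set Z := (x ^+ 2 + z ^+ 2) `^ _ in z0 zl *.
set X := (x ^+ 2) `^ _ in yl zl *.
have h1 : b * kap * x * Y <= b * kap * x * X by rewrite ler_wpM2l.
have h2 : b * kap * x * Z <= b * kap * x * X by rewrite ler_wpM2l.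
have h3 : 0 <= b * kap * x * Y by rewrite mulr_ge0.
have h4 : 0 <= b * kap * x * Z by rewrite mulr_ge0.
by apply/andP; split; lra.
Qed.

Section orbits.
Context {R : realType} {alpha h : R} {S T : \bar R} {q : R -> 'rV[R]_3} {v : R -> R}.
Context (alpha_gt0 : 0 < alpha) (alpha_lt2 : alpha < 2).
Context (orb : regularized_orbit alpha h S T q v).

Lemma coordinate_continuous (t : R) (l : 'I_3) : (S < t%:E < T)%E ->
  {for t, continuous (fun s => q s 0 l)}.
Proof.
move=> tST; apply: (@cvg_comp _ _ _ q (fun m : 'rV[R]_3 => m 0 l)).
  exact: (orbit_continuous orb tST).
exact: coord_continuous.
Qed.

Lemma rho_gt0 (p : 'rV[R]_3) : p != 0 -> 0 < rho p.
Proof.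
move=> p0; rewrite sqrtr_gt0 lt_neqAle dot_ge0 andbT eq_sym.
apply: contra p0 => /eqP; rewrite (dotE _ _ 0) -!expr2 => e.
have := sqr_ge0 (p 0 0); have := sqr_ge0 (p 0 (0 + 1)).
have := sqr_ge0 (p 0 (0 + 1 + 1)) => e1 e2 e3.
have z l : p 0 l ^+ 2 <= 0 -> p 0 l = 0.
  by move=> le0; apply/eqP; rewrite -sqrf_eq0 eq_le le0 sqr_ge0.
apply/eqP/rowP => l; rewrite mxE; apply: z.
by have /or3P[/eqP->|/eqP->|/eqP->] := axis_cases 0 l; lra.
Qed.

Lemma rho_continuous t : (S < t%:E < T)%E -> {for t, continuous (fun s => rho (q s))}.
Proof.
move=> tST; apply: (@cvg_comp _ _ _ (fun s => dot (q s) (q s)) Num.sqrt); last first.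
  exact: sqrt_continuous.
have -> : (fun s => dot (q s) (q s)) = (fun s =>
   q s 0 0 * q s 0 0 + q s 0 (0 + 1) * q s 0 (0 + 1) +
   q s 0 (0 + 1 + 1) * q s 0 (0 + 1 + 1)) by apply/funext => s; rewrite (dotE _ _ 0).
have c l := coordinate_continuous t l tST.
by rewrite (dotE _ _ 0); apply: cvgD; [apply: cvgD|]; apply: cvgM; exact: c.
Qed.

Lemma mcgehee_vE (p w : 'rV[R]_3) : p != 0 ->
  rho p `^ (1 - alpha / 2) * mcgehee_v alpha p w = dot p w.
Proof.
move=> /rho_gt0 p0.
have -> : mcgehee_v alpha p w = rho p `^ (alpha / 2) * (rho p)^-1 * dot p w.
  rewrite /mcgehee_v /mcgehee_z /mcgehee_s !(dotE _ _ 0) !mxE; ring.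
rewrite !mulrA -powRD; last by rewrite (gt_eqF p0) implybT.
by rewrite subrK powRr1 ?(ltW p0)// mulfV ?gt_eqF// mul1r.
Qed.

Lemma derivable_coordinate (p : R -> 'rV[R]_3) t (l : 'I_3) : derivable p t 1 ->
  is_derive t 1 (fun s => p s 0 l) (derive1 p t 0 l).
Proof.
move=> dp; split; first by move/derivable_mxP : dp => /(_ 0 l).
by rewrite derive1E derive_mx// mxE.
Qed.

(** The reflection [sg] is harmless because the potential is even in each
    coordinate. *)
Lemma axis_orbit_of (k : 'I_3) (sg : R) : sg ^+ 2 = 1 ->
  axis_orbit (alpha / 2) h (4 `^ (- (alpha / 2))) S T
    (fun t => sg * q t 0 k) (fun t => q t 0 (k + 1)) (fun t => q t 0 (k + 1 + 1))
    (fun t => rho (q t) `^ (1 - alpha / 2) * v t) (fun t => collision (q t)).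
Proof.
move=> sg2.
have sg0 : sg != 0 by rewrite -sqrf_eq0 sg2 oner_eq0.
pose x t := sg * q t 0 k.
have fin a c : (S < a%:E)%E -> (c%:E < T)%E ->
    finite_set [set t | a <= t <= c /\ collision (q t)].
  exact: (orbit_collisions orb).
have dq t l : (S < t%:E < T)%E -> ~ collision (q t) ->
    is_derive t 1 (fun s => q s 0 l) (velocity q t 0 l).
  move=> tST Ct; apply: derivable_coordinate.
  by have [] := orbit_derivable orb tST Ct.
have dx t : (S < t%:E < T)%E -> ~ collision (q t) ->
    is_derive t 1 x (sg * velocity q t 0 k).
  move=> tST Ct; have D := dq t k tST Ct.
  by apply: is_derive_eq; rewrite /GRing.scale /=; ring.
have ddx t : (S < t%:E < T)%E -> ~ collision (q t) ->
    is_derive t 1 (derive1 x) (sg * derive1 (velocity q) t 0 k).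
  move=> tST Ct; have [_ dv] := orbit_derivable orb tST Ct.
  have D := derivable_coordinate (velocity q) t k dv.
  have D' : is_derive t 1 (fun s => sg * velocity q s 0 k) (sg * derive1 (velocity q) t 0 k).
    by apply: is_derive_eq; rewrite /GRing.scale /=; ring.
  have E : {near t, (fun s => sg * velocity q s 0 k) =1 derive1 x}.
    near=> s; apply/esym; rewrite derive1E.
    have Cs : ~ collision (q s).
      near: s; exact: (near_collision_free_at fin).
    have sST : (S < s%:E < T)%E by near: s; exact: near_inside.
    by have D2 := dx s sST Cs; rewrite derive_val.
  split; first exact: near_eq_derivable E ex_derive.
  have <- : 'D_1 (fun s => sg * velocity q s 0 k) t = sg * derive1 (velocity q) t 0 k.
    exact: derive_val.
  exact/esym/near_eq_derive.
split.
- move=> t tST; apply: continuousM; first exact: cst_continuous.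
  exact: coordinate_continuous.
- by move=> t tST; exact: coordinate_continuous.
- by move=> t tST; exact: coordinate_continuous.
- move=> t tST; apply: continuousM; last exact: (orbit_v_continuous orb tST).
  have r0 := rho_gt0 _ (orbit_neq0 orb tST).
  exact: (cvg_comp _ _ (rho_continuous t tST) (powR_continuous (1 - alpha / 2) _ r0)).
- exact: fin.
- move=> t Ct x0; apply: collision_off_axis => //.
  by apply: contraTneq x0 => ->; rewrite mulr0 ltxx.
- move=> t Ct.
  rewrite lt_neqAle addr_ge0 ?sqr_ge0// andbT eq_sym; apply/eqP => /eqP.
  rewrite paddr_eq0 ?sqr_ge0// !sqrf_eq0 => /andP[/eqP y0 /eqP z0].
  by apply: Ct; exact: (collision_on_axis _ k).
- move=> t tST Ct; split.
  + by have D := dx t tST Ct; exact: ex_derive.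
  + by have D := dq t (k + 1) tST Ct; exact: ex_derive.
  + by have D := dq t (k + 1 + 1) tST Ct; exact: ex_derive.
  + by have D := ddx t tST Ct; exact: ex_derive.
- move=> t tST Ct x0.
  have xE : x t ^+ 2 = q t 0 k ^+ 2 by rewrite /x exprMn sg2 mul1r.
  have D := ddx t tST Ct; rewrite derive1E derive_val (orbit_newton orb tST Ct).
  rewrite /grad mxE derive_along.
  have -> : (fun s : R => potential alpha (s *: delta_mx 0 k + q t)) =
    (fun s => axis_potential (alpha / 2) (4 `^ (- (alpha / 2))) (s + q t 0 k)
       (q t 0 (k + 1)) (q t 0 (k + 1 + 1))).
    apply/funext => s; rewrite (potentialE _ _ k) !mxE !eqxx !axis_neq.
    by rewrite !mulr0 !add0r mulr1.
  have qk0 : 0 < q t 0 k ^+ 2 by rewrite -xE exprn_gt0.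
  have D2 := @is_derive_axis_potential _ (alpha / 2) (4 `^ (- (alpha / 2)))
    (q t 0 k) (q t 0 (k + 1)) (q t 0 (k + 1 + 1)).
  have {}D2 := D2 (ltr_wpDr (sqr_ge0 _) qk0) (ltr_wpDr (sqr_ge0 _) qk0).
  rewrite derive_val -xE mulrN.
  have := @axis_force_bounds _ (alpha / 2) (4 `^ (- (alpha / 2))) (x t)
    (q t 0 (k + 1)) (q t 0 (k + 1 + 1)).
  move=> /(_ _ _ x0); rewrite powR_ge0 divr_ge0 ?(ltW alpha_gt0)// => /(_ isT isT).
  set X := (_ `^ _ + _ `^ _)%R.
  suff -> : sg * (2 * (alpha / 2) * 4 `^ (- (alpha / 2)) * q t 0 k * X) =
    2 * (alpha / 2) * 4 `^ (- (alpha / 2)) * x t * X by [].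
  by rewrite /x; ring.
- move=> t tST Ct; rewrite -[RHS](orbit_energy orb tST Ct) /energy (potentialE _ _ k).
  have Dx := dx t tST Ct; have Dy := dq t (k + 1) tST Ct.
  have Dz := dq t (k + 1 + 1) tST Ct.
  rewrite (enorm_sqr _ k) !derive1E !derive_val exprMn sg2 mul1r.
  by rewrite /axis_potential exprMn sg2 mul1r.
- move=> t tST Ct.
  have Dx := dx t tST Ct; have Dy := dq t (k + 1) tST Ct.
  have Dz := dq t (k + 1 + 1) tST Ct.
  rewrite (orbit_v orb tST Ct) mcgehee_vE; last exact: (orbit_neq0 orb tST).
  rewrite (dotE _ _ k) !derive1E !derive_val mulrACA -expr2 sg2 mul1r.
  by [].
Unshelve. all: by end_near. Qed.
End orbits.

(** * Launching condition and conclusion *)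

(** The bound of [initial_bounds], where [H] is the value that makes
    [H * rho^(-alpha) >= |h|] whenever [rho <= r]. *)
Definition escape_speed {R : realType} (alpha h r : R) : R :=
  2 * (`|h| * r `^ alpha) + 18 + 2 * (108 + `|h| * r `^ alpha).

Section launch.
Context {R : realType} {alpha h : R} {S T : \bar R} {q : R -> 'rV[R]_3} {v : R -> R}.
Context (alpha_gt0 : 0 < alpha) (alpha_lt2 : alpha < 2).
Context (orb : regularized_orbit alpha h S T q v).

(** The factor [4] (rather than [3], which some axis always achieves) makes this
    an open condition near a configuration where [k] is the dominant axis. *)
Definition launched (k : 'I_3) (r t : R) : Prop :=
  [/\ (S < t%:E < T)%E, ~ collision (q t), rho (q t) <= r,
      rho (q t) ^+ 2 <= 4 * q t 0 k ^+ 2 & escape_speed alpha h r <= v t].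

(** A finite end time is excluded because [q] would converge there to a
    configuration with positive axial coordinate, against maximality. *)
Lemma launched_escape (k : 'I_3) (r t1 : R) : launched k r t1 ->
  [/\ forall t, t1 <= t -> (t%:E < T)%E ->
        4 * (q t 0 (k + 1) ^+ 2 + q t 0 (k + 1 + 1) ^+ 2) <= q t 0 k ^+ 2 /\
        16 * (q t 0 (k + 1) ^+ 2 + q t 0 (k + 1 + 1) ^+ 2) <= rho (q t1) ^+ 2,
      forall t t', t1 <= t -> t < t' -> (t'%:E < T)%E -> rho (q t) < rho (q t'),
      exists2 w : R, 0 < w &
        forall t, t1 <= t -> (t%:E < T)%E -> w * (t - t1) <= rho (q t)
    & forward_maximal T q -> T = +oo%E].
Proof.
move=> [t1ST Ct1 rr rk vr].
have r0 := rho_gt0 _ (orbit_neq0 orb t1ST).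
have qk0 : q t1 0 k != 0.
  have : 0 < q t1 0 k ^+ 2.
    by have := exprn_gt0 2 r0; move=> h0; rewrite -(ltr_pM2l (_ : 0 < 4)) ?mulr0//; exact: lt_le_trans rk.
  by apply: contraTneq => ->; rewrite expr0n ltxx.
pose sg := Num.sg (q t1 0 k).
have sg2 : sg ^+ 2 = 1 by rewrite /sg sqr_sg qk0.
have O := axis_orbit_of alpha_gt0 orb k sg sg2.
set b := alpha / 2 in O; set kap := 4 `^ (- b) in O.
set x := (fun t => sg * q t 0 k) in O.
set y := (fun t => q t 0 (k + 1)) in O; set z := (fun t => q t 0 (k + 1 + 1)) in O.
set A := (fun t => _ `^ _ * v t) in O; set C := (fun t => collision (q t)) in O.
have b01 : 0 < b < 1 by rewrite /b; move: alpha_gt0 alpha_lt2 => a0 a2; apply/andP; split; lra.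
have /andP[b0 b1] := b01.
have kap01 : 0 <= kap <= 1.
  have ge1 : 1 <= 4 :> R by lra.
  have := ler_powR ge1 (ltW b0); rewrite powRr0 => p1.
  by rewrite powR_ge0 /kap powRN invf_le1 ?powR_gt0.
have x0 : 0 < x t1 by rewrite /x /sg -normrEsg normr_gt0.
have xE t : x t ^+ 2 = q t 0 k ^+ 2 by rewrite /x exprMn sg2 mul1r.
have r2E t : x t ^+ 2 + y t ^+ 2 + z t ^+ 2 = rho (q t) ^+ 2.
  by rewrite /rho (enorm_sqr _ k) xE.
have uE : axial_velocity x y z A C t1 = derive1 x t1.
  exact: (axial_velocityE O).
pose P := rho (q t1) `^ (1 - b).
pose H := `|h| * r `^ alpha.
have P2 : P ^+ 2 = (x t1 ^+ 2 + y t1 ^+ 2 + z t1 ^+ 2) *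
    (x t1 ^+ 2 + y t1 ^+ 2 + z t1 ^+ 2) `^ (- b).
  rewrite r2E mulr_powRN ?exprn_gt0// powR_sqr ?(ltW r0)// /P.
  by rewrite -powR_mulrn ?powR_ge0// -powRrM mulrC.
have hH : `|h| <= H * (x t1 ^+ 2 + y t1 ^+ 2 + z t1 ^+ 2) `^ (- b).
  rewrite r2E powR_sqr ?(ltW r0)// /H -mulrA ler_peMr//.
  have -> : 2 * - b = - alpha by rewrite /b; field.
  rewrite powRN ler_pdivlMr ?powR_gt0// mul1r ge0_ler_powR ?nnegrE//; try exact: ltW.
  by apply: le_trans rr; exact: ltW.
have [] := @initial_bounds _ b kap h H P (x t1) (y t1) (z t1) (derive1 x t1) (derive1 y t1) (derive1 z t1) _ kap01 x0 _ _ hH _ P2.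
- by rewrite !ltW.
- exact: (axis_separated O).
- by rewrite r2E xE.
- by rewrite powR_gt0.
- exact: (axis_energy O).
- rewrite -(axis_A O t1ST Ct1) /A ler_pM2l ?powR_gt0//.
rewrite -uE => u0 J1 hJ1.
have rx : x t1 ^+ 2 + y t1 ^+ 2 + z t1 ^+ 2 <= 4 * x t1 ^+ 2 by rewrite r2E xE.
have rho_le t t' : rho (q t) ^+ 2 < rho (q t') ^+ 2 -> rho (q t) < rho (q t').
  by rewrite ltr_sqr // nnegrE sqrtr_ge0.
split.
- move=> t t1t tT; rewrite -(xE t) -r2E; split.
    exact: (transverse_le_axial b01 kap01 O t1ST x0 (ltW u0) rx J1 hJ1).
  exact: (transverse_bound b01 kap01 O t1ST x0 (ltW u0) J1 hJ1).
- move=> t t' t1t tt' t'T; apply: rho_le; rewrite -!r2E.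
  exact: (radius_increasing b01 kap01 O t1ST x0 (ltW u0) rx J1 hJ1).
- have W0 : 0 < (x t1 ^+ 2 + y t1 ^+ 2 + z t1 ^+ 2) `^ (- b).
    by rewrite powR_gt0 // r2E exprn_gt0.
  have J0 : 0 < axial_energy b kap (x t1) (axial_velocity x y z A C t1).
    by apply: lt_le_trans J1; rewrite mulr_gt0.
  exists (Num.sqrt (2 * axial_energy b kap (x t1) (axial_velocity x y z A C t1))).
    by rewrite sqrtr_gt0 mulr_gt0.
  move=> t t1t tT.
  have xt := axial_position_ge b01 kap01 O t1ST x0 (ltW u0) J0 t t1t tT.
  apply: (le_trans (y := x t)); first by apply: le_trans xt; rewrite lerDr ltW.
  apply: le_trans (ler_norm _) _; rewrite -[leRHS]ger0_norm ?sqrtr_ge0//.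
  by rewrite -ler_sqr ?nnegrE// !real_normK ?num_real// -r2E -addrA lerDl addr_ge0 ?sqr_ge0.
- move=> fm; case: (T) t1ST O fm => [c| |] t1ST' O' fm //; last by case/andP: t1ST'.
  have [cx cy cz] := position_cvg b01 kap01 O' t1ST' x0 (ltW u0) J1 hJ1 erefl.
  exfalso.
  pose l : 'rV[R]_3 := (sg * lim (x t @[t --> c^'-])) *: delta_mx 0 k +
     lim (y t @[t --> c^'-]) *: delta_mx 0 (k + 1) +
     lim (z t @[t --> c^'-]) *: delta_mx 0 (k + 1 + 1).
  have ql : q t @[t --> c^'-] --> l.
    have -> : q = (fun t => (sg * x t) *: delta_mx 0 k + y t *: delta_mx 0 (k + 1)
       + z t *: delta_mx 0 (k + 1 + 1)).
      apply/funext => t; rewrite [LHS]row_sum_delta (sum_axes _ k).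
      by rewrite /x mulrA -expr2 sg2 mul1r.
    apply: cvgD; first apply: cvgD; apply: cvgZr_tmp => //.
    by apply: cvgM => //; exact: cvg_cst.
  have l0 := fm c l erefl ql.
  have lim0 : lim (x t @[t --> c^'-]) = 0.
    have : l 0 k = 0 by rewrite l0 mxE.
    rewrite /l !mxE !eqxx !axis_neq !mulr0 !addr0 mulr1 => /eqP.
    by rewrite mulf_eq0 -sqrf_eq0 sg2 oner_eq0 => /eqP.
  have /andP[_] := t1ST'; rewrite lte_fin => t1c.
  have J0 : 0 < axial_energy b kap (x t1) (axial_velocity x y z A C t1).
    by apply: lt_le_trans J1; rewrite mulr_gt0 // powR_gt0 // r2E exprn_gt0.
  have : x t1 <= lim (x t @[t --> c^'-]).
    apply: limr_ge => //; near=> t.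
    have [] // := axial_escape b01 kap01 O' t1ST' x0 (ltW u0) J0 t.
      by near: t; exact: nbhs_left_ge.
    by rewrite lte_fin; near: t; exact: nbhs_left_lt.
  by rewrite lim0 leNgt x0.
Unshelve. all: by end_near. Qed.

End launch.

Lemma exists_dominant_axis {R : realType} (p : 'rV[R]_3) :
  exists k, enorm p ^+ 2 <= 3 * p 0 k ^+ 2.
Proof.
have H l : (forall m, p 0 m ^+ 2 <= p 0 l ^+ 2) -> enorm p ^+ 2 <= 3 * p 0 l ^+ 2.
  by move=> hl; rewrite (enorm_sqr _ l); have := hl (l + 1); have := hl (l + 1 + 1); lra.
have [l _ hl] := @arg_maxP _ _ 'I_3 0 predT (fun l => p 0 l ^+ 2) isT.
by exists l; apply: H => m; exact: hl.
Qed.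

(** The initial time may be a collision, where the energy relation says nothing;
    the times just after it are not. *)
Lemma near_launched {R : realType} (alpha h : R) (S T : \bar R) (q : R -> 'rV[R]_3)
    (v : R -> R) (k : 'I_3) (r t0 : R) :
  regularized_orbit alpha h S T q v -> (S < t0%:E < T)%E ->
  rho (q t0) < r -> rho (q t0) ^+ 2 <= 3 * q t0 0 k ^+ 2 ->
  escape_speed alpha h r < v t0 ->
  \forall t \near t0^'+, @launched R alpha h S T q v k r t.
Proof.
move=> orb t0ST rr rk vr.
have r0 := rho_gt0 _ (orbit_neq0 orb t0ST).
have crho := rho_continuous orb t0 t0ST.
have csq : 4 * q t 0 k ^+ 2 - rho (q t) ^+ 2 @[t --> t0] -->
    4 * q t0 0 k ^+ 2 - rho (q t0) ^+ 2.
  apply: cvgB; last first.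
    by apply: (@cvg_comp _ _ _ _ (fun x : R => x ^+ 2)); [exact: crho|exact: exprn_continuous].
  apply: cvgM; first exact: cvg_cst.
  apply: (@cvg_comp _ _ _ _ (fun x : R => x ^+ 2)); last exact: exprn_continuous.
  exact: coordinate_continuous orb t0 k t0ST.
have pos : 0 < 4 * q t0 0 k ^+ 2 - rho (q t0) ^+ 2.
  by have := exprn_gt0 2 r0; lra.
near=> t.
have t0t : t0 < t by near: t; exact: nbhs_right_gt.
split.
- by near: t; apply: nbhs_at_right; exact: near_inside.
- have : t != t0 by rewrite gt_eqF.
  near: t; apply: nbhs_at_right.
  exact: (near_collision_free (orbit_collisions orb)).
- by apply: ltW; near: t; apply: nbhs_at_right; exact: (cvgr_lt _ crho).
- by rewrite -subr_ge0; apply: ltW; near: t; apply: nbhs_at_right; exact: (cvgr_gt _ csq).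
- by apply: ltW; near: t; apply: nbhs_at_right; exact: (cvgr_gt _ (orbit_v_continuous orb t0ST)).
Unshelve. all: by end_near. Qed.

Theorem proposition4p2 (R : realType) (alpha r h : R)
    (alpha_gt0 : 0 < alpha) (alpha_lt2 : alpha < 2) (r_gt0 : 0 < r) :
  exists c : R,
  forall (S T : \bar R) (q : R -> 'rV[R]_3) (v : R -> R) (t0 : R),
    regularized_orbit alpha h S T q v -> forward_maximal T q ->
    (S < t0%:E < T)%E -> rho (q t0) <= r -> c <= v t0 ->
  [/\ exists g1 g2 g3 g4 : D2,
        [/\ uniq [:: g1; g2; g3; g4],
            forall t, t0 <= t -> (t%:E < T)%E ->
              shortest_pair (q t) g1 g2 g3 g4
          & exists B : R, forall t, t0 <= t -> (t%:E < T)%E ->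
              edge (q t) g1 g2 <= B /\ edge (q t) g3 g4 <= B],
      forall t t', t0 <= t -> t < t' -> (t'%:E < T)%E ->
        rho (q t) < rho (q t')
    & forall M : R, exists2 t1 : R, (t0%:E <= t1%:E < T)%E &
        forall t, t1 <= t -> (t%:E < T)%E -> M <= rho (q t)].
Proof.
exists (escape_speed alpha h (2 * r) + 1) => S T q v t0 orb fm t0ST rr vc.
have /andP[St0 t0T] := t0ST.
have [k rk] := exists_dominant_axis (q t0).
have near_l : \forall t \near t0^'+, @launched R alpha h S T q v k (2 * r) t.
  by apply: (near_launched alpha h S T q v k _ t0 orb t0ST) => //; lra.
have launch t : t0 < t -> exists2 t1, t0 < t1 <= t & @launched R alpha h S T q v k (2 * r) t1.
  move=> t0t.
  have : \forall s \near t0^'+, t0 < s <= t /\ @launched R alpha h S T q v k (2 * r) s.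
    near=> s; split; last by near: s.
    by apply/andP; split; near: s; [exact: nbhs_right_gt|exact: nbhs_right_ltW].
  by move=> /filter_ex[s [? ?]]; exists s.
have esc t1 := @launched_escape R alpha h S T q v alpha_gt0 alpha_lt2 orb k (2 * r) t1.
(* The bounds hold after [t0] and pass to [t0] by continuity, so they are
   stated as closed conditions that still separate the edges strictly. *)
pose e t := q t 0 (k + 1) ^+ 2 + q t 0 (k + 1 + 1) ^+ 2.
have inside t : t0 <= t -> (t%:E < T)%E -> (S < t%:E < T)%E.
  by move=> t0t tT; rewrite tT (lt_le_trans St0)// lee_fin.
have tight_gt t : t0 < t -> (t%:E < T)%E -> 0 <= q t 0 k ^+ 2 - 4 * e t /\ 0 <= r ^+ 2 - 4 * e t.
  move=> t0t tT; have [t1 /andP[t01 t1t] l1] := launch t t0t.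
  have [tight _ _ _] := esc t1 l1.
  have [h1 h2] := tight t t1t tT; split; first by rewrite subr_ge0.
  have [_ _ rt1 _ _] := l1.
  have : rho (q t1) ^+ 2 <= (2 * r) ^+ 2.
    by rewrite ler_sqr ?nnegrE ?sqrtr_ge0// mulr_ge0 // ltW.
  by rewrite /e exprMn; lra.
have csq l t : (S < t%:E < T)%E -> q s 0 l ^+ 2 @[s --> t] --> q t 0 l ^+ 2.
  move=> tST; apply: (@cvg_comp _ _ _ _ (fun x : R => x ^+ 2)); last exact: exprn_continuous.
  exact: coordinate_continuous orb t l tST.
have ce t : (S < t%:E < T)%E -> 4 * e s @[s --> t] --> 4 * e t.
  by move=> tST; apply: cvgM; [exact: cvg_cst|apply: cvgD; exact: csq].
have near_T : \forall t \near t0^'+, (t%:E < T)%E.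
  by near=> t; suff /andP[] : (S < t%:E < T)%E by []; near: t; apply: nbhs_at_right; exact: near_inside.
have tight t : t0 <= t -> (t%:E < T)%E -> 4 * e t <= q t 0 k ^+ 2 /\ 4 * e t <= r ^+ 2.
  rewrite le_eqVlt => /predU1P[<-{t} _|t0t tT]; last first.
    by have [h1 h2] := tight_gt t t0t tT; rewrite -!(subr_ge0 (4 * e t)).
  rewrite -!(subr_ge0 (4 * e t0)); split.
  - apply: (@cvgr_to_ge _ _ _ _ (fun t => q t 0 k ^+ 2 - 4 * e t) _ _ (cvg_at_right_filter (cvgB (csq k t0 t0ST) (ce t0 t0ST)))).
    near=> t.
    have [|//|//] := tight_gt t; first by near: t; exact: nbhs_right_gt.
    by near: t.
  - apply: (@cvgr_to_ge _ _ _ _ (fun t => r ^+ 2 - 4 * e t) _ _ (cvg_at_right_filter (cvgB (cvg_cst _) (ce t0 t0ST)))).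
    near=> t.
    have [|//|//] := tight_gt t; first by near: t; exact: nbhs_right_gt.
    by near: t.
have qk0 t : t0 <= t -> (t%:E < T)%E -> 0 < q t 0 k ^+ 2.
  move=> t0t tT; have [h1 _] := tight t t0t tT.
  have := exprn_gt0 2 (rho_gt0 _ (orbit_neq0 orb (inside t t0t tT))).
  rewrite (enorm_sqr _ k) -addrA -/(e t); have := sqr_ge0 (q t 0 k); lra.
have incr_gt t t' : t0 < t -> t < t' -> (t'%:E < T)%E -> rho (q t) < rho (q t').
  move=> t0t tt' t'T; have [t1 /andP[t01 t1t] l1] := launch t t0t.
  by have [_ incr _ _] := esc t1 l1; exact: incr.
split.
- exists None, (Some k), (Some (k + 1)), (Some (k + 1 + 1)); split.
  + by rewrite /= !inE !(inj_eq Some_inj) !axis_neq.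
  + move=> t t0t tT; have [h1 _] := tight t t0t tT; have h2 := qk0 t t0t tT.
    have := sqr_ge0 (q t 0 (k + 1)); have := sqr_ge0 (q t 0 (k + 1 + 1)).
    by move=> h3 h4; apply: shortest_pair_axis; rewrite /e in h1; lra.
  + exists r => t t0t tT; have [_ h1] := tight t t0t tT.
    rewrite edge_rotation (edge_rotations _ (k + 1)) -/(e t).
    have : Num.sqrt (4 * e t) <= Num.sqrt (r ^+ 2) by rewrite ler_wsqrtr.
    by rewrite sqrtr_sqr ger0_norm ?(ltW r_gt0).
- move=> t t'; rewrite le_eqVlt => /predU1P[<-{t} t0t' t'T|]; last exact: incr_gt.
  pose s := (t0 + t') / 2.
  have t0s : t0 < s by rewrite /s; lra.
  have st' : s < t' by rewrite /s; lra.
  apply: le_lt_trans (incr_gt s t' t0s st' t'T).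
  apply: (cvgr_to_le (cvg_at_right_filter (rho_continuous orb t0 t0ST))).
  have sT : (s%:E < T)%E by apply: lt_trans t'T; rewrite lte_fin.
  near=> p.
  have t0p : t0 < p by near: p; exact: nbhs_right_gt.
  have ps : p < s by near: p; exact: nbhs_right_lt.
  exact/ltW/incr_gt.
- move=> M; have [t1 /andP[t01 _] l1] := launch (t0 + 1) (ltr_pwDr ltr01 (lexx t0)).
  have [_ _ [w w0 grow] TE] := esc t1 l1; rewrite (TE fm) in grow *.
  exists (t1 + `|M| / w).
    rewrite ltry lee_fin andbT; apply: (le_trans (ltW t01)).
    by rewrite lerDl divr_ge0// ltW.
  move=> t tM _; have d0 : 0 <= `|M| / w by rewrite divr_ge0// ltW.
  apply: le_trans (grow t _ (ltry _)); last lra.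
  apply: (le_trans (ler_norm M)).
  by rewrite mulrC -ler_pdivrMr//; lra.
Unshelve. all: by end_near. Qed.
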